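(* Let $\mathcal F$ be an ordinary differential field of characteristic zero and let $\mathcal I\subset \mathcal F\{y_1,\ldots,y_n\}$ be a prime differential ideal of dimension $d$ and order $h$. Let $f$ be a generic differential polynomial of order $s$ and degree greater than zero, and let $\mathbf u_f$ denote its set of coefficients. If $d>0$, then $\mathcal I_1=[\mathcal I,f]$, the differential ideal generated by $\mathcal I$ and $f$ in $\mathcal F\langle \mathbf u_f\rangle\{y_1,\ldots,y_n\}$, is a prime differential ideal of dimension $d-1$ and order $h+s$. If $d=0$, then $\mathcal I_1$ is the unit ideal in $\mathcal F\langle \mathbf u_f\rangle\{y_1,\ldots,y_n\}$.
   Context: $\mathcal F$ is an ordinary differential field of characteristic $0$ with derivation $\delta$; $\mathcal E$ is a fixed universal differential extension field of $\mathcal F$; $y_1,\dots,y_n$ are differential indeterminates. For a prime differential ideal $\mathcal I$ with generic point $\eta=(\eta_1,\dots,\eta_n)$, its dimension is the differential transcendence degree of $\mathcal F\langle\eta\rangle$ over $\mathcal F$, and there is a numerical polynomial $\omega(t)$ with $\omega(t)=\operatorname{tr.deg}\mathcal F(\eta_i^{(j)}: i\le n, j\le t)/\mathcal F$ for all large $t$; it has the form $\omega(t)=d(t+1)+h$, and $h$ is called the order of $\mathcal I$. A generic differential polynomial of order $s$ and degree $r$ is $f=\sum_{m}u_m m$, where $m$ ranges over all differential monomials in $y_1,\dots,y_n$ of order $\le s$ and total degree $\le r$ (including the monomial $1$), and the coefficients $u_m\in\mathcal E$ are differential indeterminates over $\mathcal F$ (differentially independent over $\mathcal F$). $\mathcal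 F\langle \mathbf u_f\rangle$ denotes the differential field generated over $\mathcal F$ by the coefficients. *)

(* Defs.v *)
From HB Require Import structures.
From mathcomp Require Import all_boot all_order all_algebra.
From mathcomp Require Import mpoly.
Set Implicit Arguments. Unset Strict Implicit. Unset Printing Implicit Defensive.
Import Order.TTheory GRing.Theory.
Local Open Scope ring_scope.

(* monomials of order <= s and total degree <= r in y_1..y_n (exponent of y_i^(j)) *)
Notation monom n s r :=
  {m : {ffun 'I_n * 'I_s.+1 -> 'I_r.+1} | (\sum_v (m v : nat) <= r)%N}.

(* Differential algebra inside a fixed ambient differential field (E, D).
   Subfields of E are predicates K : E -> Prop. *)
Section DiffAlg.
Variable E : fieldType.
Variable D : E -> E.

Definition is_derivation : Prop :=
  (forall x y, D (x + y) = D x + D y) /\ (forall x y, D (x * y) = D x * y + x * D y).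

Definition is_dsubfield (K : E -> Prop) : Prop :=
  K 0 /\ K 1 /\ (forall x y, K x -> K y -> K (x - y)) /\
  (forall x y, K x -> K y -> K (x * y)) /\
  (forall x, K x -> K x^-1) /\ (forall x, K x -> K (D x)).

(* Differential polynomials (syntax) in differential indeterminates indexed
   by V; DPv v j stands for the j-th derivative y_v^(j). *)
Inductive dpoly (V : Type) : Type :=
| DPc of E
| DPv of V & nat
| DPadd of dpoly V & dpoly V
| DPmul of dpoly V & dpoly V.

Arguments DPc {V}.

Section Terms.
Variable V : Type.

Fixpoint dp_coeffs_in (K : E -> Prop) (P : dpoly V) : Prop :=
  match P with
  | DPc c => K c
  | DPv _ _ => True
  | DPadd P Q => dp_coeffs_in K P /\ dp_coeffs_in K Q
  | DPmul P Q => dp_coeffs_in K P /\ dp_coeffs_in K Q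
  end.

Fixpoint dp_eval (a : V -> nat -> E) (P : dpoly V) : E :=
  match P with
  | DPc c => c
  | DPv v j => a v j
  | DPadd P Q => dp_eval a P + dp_eval a Q
  | DPmul P Q => dp_eval a P * dp_eval a Q
  end.

Fixpoint dp_deriv (P : dpoly V) : dpoly V :=
  match P with
  | DPc c => DPc (D c)
  | DPv v j => DPv v j.+1
  | DPadd P Q => DPadd (dp_deriv P) (dp_deriv Q)
  | DPmul P Q => DPadd (DPmul (dp_deriv P) Q) (DPmul P (dp_deriv Q))
  end.

(* equality of differential polynomials = equality as polynomials in the
   (algebraically independent) variables y_v^(j); since E is infinite this is
   equality of the polynomial functions. *)
Definition dp_eq (P Q : dpoly V) : Prop :=
  forall a : V -> nat -> E, dp_eval a P = dp_eval a Q.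

Definition djet (x : V -> E) : V -> nat -> E := fun v j => iter j D (x v).

(* a differential ideal of K{y_V}, given as a set of (representatives of)
   differential polynomials with coefficients in K *)
Definition is_dideal (K : E -> Prop) (J : dpoly V -> Prop) : Prop :=
  (forall P, J P -> dp_coeffs_in K P) /\
  J (DPc 0) /\
  (forall P Q, dp_coeffs_in K Q -> dp_eq P Q -> J P -> J Q) /\
  (forall P Q, J P -> J Q -> J (DPadd P Q)) /\
  (forall P Q, dp_coeffs_in K P -> J Q -> J (DPmul P Q)) /\
  (forall P, J P -> J (dp_deriv P)).

Definition is_prime_dideal (K : E -> Prop) (J : dpoly V -> Prop) : Prop :=
  [/\ is_dideal K J, ~ J (DPc 1) &
      (forall P Q, dp_coeffs_in K P -> dp_coeffs_in K Q ->
         J (DPmul P Q) -> J P \/ J Q)].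

Definition dideal_gen (K : E -> Prop) (S : dpoly V -> Prop) : dpoly V -> Prop :=
  fun P => dp_coeffs_in K P /\
    exists l : seq (dpoly V * nat * dpoly V),
      foldr (fun t acc => (dp_coeffs_in K t.1.1 /\ S t.2) /\ acc) True l /\
      dp_eq P (foldr (fun t acc => DPadd (DPmul t.1.1 (iter t.1.2 dp_deriv t.2)) acc)
                     (DPc 0) l).

Definition is_generic_zero (K : E -> Prop) (J : dpoly V -> Prop) (eta : V -> E) : Prop :=
  forall P, dp_coeffs_in K P -> (J P <-> dp_eval (djet eta) P = 0).

Definition dfgen (K : E -> Prop) (x : V -> E) : E -> Prop :=
  fun z => exists P Q : dpoly V, [/\ dp_coeffs_in K P, dp_coeffs_in K Q,
     dp_eval (djet x) Q != 0 & z = dp_eval (djet x) P / dp_eval (djet x) Q].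

End Terms.

Definition alg_indep (K : E -> Prop) (x : seq E) : Prop :=
  forall p : {mpoly E[size x]}, (forall m, K p@_m) ->
    p.@[fun i : 'I_(size x) => x`_i] = 0 -> p = 0.

Definition trdeg (K : E -> Prop) (x : seq E) (k : nat) : Prop :=
  (exists t : seq E, [/\ {subset t <= x}, size t = k & alg_indep K t]) /\
  (forall t : seq E, {subset t <= x} -> alg_indep K t -> (size t <= k)%N).

Definition dindep (K : E -> Prop) (x : seq E) : Prop :=
  forall N : nat, alg_indep K (flatten [seq map (iter j D) x | j <- iota 0 N]).

Definition dtrdeg (K G : E -> Prop) (d : nat) : Prop :=
  (exists t : seq E, [/\ (forall z, z \in t -> G z), size t = d & dindep K t]) /\
  (forall t : seq E, (forall z, z \in t -> G z) -> dindep K t -> (size t <= d)%N).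

Definition jets_upto (n : nat) (eta : 'I_n -> E) (t : nat) : seq E :=
  flatten [seq [seq iter j D (eta i) | i <- enum 'I_n] | j <- iota 0 t.+1].

Definition dim_order (n : nat) (K : E -> Prop) (J : dpoly 'I_n -> Prop) (d h : nat) : Prop :=
  exists eta : 'I_n -> E, [/\ is_generic_zero K J eta,
    dtrdeg K (dfgen K eta) d &
    exists T : nat, forall t, (T <= t)%N -> trdeg K (jets_upto eta t) (d * t.+1 + h)].

(* E is a universal differential extension of F: every finitely generated
   differential extension of a finitely generated G = F<x> inside E embeds in E
   over G, i.e. every prime differential ideal of G{y_1..y_m} has a generic zero in E *)
Definition universal (F : E -> Prop) : Prop :=
  forall (V : finType) (x : V -> E) (m : nat) (J : dpoly 'I_m -> Prop),
    is_prime_dideal (dfgen F x) J -> exists eta : 'I_m -> E, is_generic_zero (dfgen F x) J eta.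

Definition dp_pow (V : Type) (P : dpoly V) (k : nat) : dpoly V := iter k (DPmul P) (DPc 1).

Definition dp_monom (n s r : nat) (m : monom n s r) : dpoly 'I_n :=
  foldr (fun (v : ('I_n * 'I_s.+1)%type) acc => DPmul (dp_pow (DPv v.1 (v.2 : nat)) (val m v)) acc) (DPc 1)
        (enum (predT : pred ('I_n * 'I_s.+1)%type)).

Definition generic_dpoly (n s r : nat) (u : monom n s r -> E) : dpoly 'I_n :=
  foldr (fun m acc => DPadd (DPmul (DPc (u m)) (dp_monom m)) acc) (DPc 0)
        (enum (predT : pred (monom n s r))).

End DiffAlg.
Arguments DPc {E V}.

(* Main.v *)
(** Let [eta] be a generic zero of [I] over F and choose, by universality, a family
    [w0] indexed by the monomials that is differentially independent over F<eta>.
    Replacing its entry at the monomial 1 by minus the value at [eta] of the other terms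
    gives a family [z] with [f_z(eta) = 0].

    If d > 0, some [eta_i] has every derivative transcendental over the lower jets of
    [eta]. Since the coefficient of y_i^(s) in f is a fresh transcendental, the k-th
    derivative of the modified entry is transcendental over the other coefficients and the
    jets of [eta] of order < k + s. Hence [z] is again independent over F, so F<u> and
    F<z> are isomorphic, and the ideal of [eta] over F<z> pulls back to a prime ideal J of
    F<u>{y}. A polynomial over F in (z, y) that vanishes at (z, eta) becomes, modulo the
    derivatives of f, a polynomial in (w0, y) whose coefficients vanish at [eta], hence
    lie in I; this gives J = [I, f]. Counting jets up to order t, t + 1 - s derivatives of
    the modified entry are used up, so d(t+1) + h drops to (d-1)(t+1) + h + s.

    If d = 0, the transcendence degree of the jets of [eta] is bounded, so [z] is
    dependent over F; the same elimination turns a relation q(z) = 0 into q(u) in [I, f]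
    with q(u) a nonzero constant. *)

Require Import Defs.
From HB Require Import structures.
From mathcomp Require Import all_boot all_order all_algebra.
From mathcomp Require Import mpoly.
From mathcomp Require Import ring zify.
From Stdlib Require Import ClassicalEpsilon.
Set Implicit Arguments. Unset Strict Implicit. Unset Printing Implicit Defensive.
Import GRing.Theory.
Local Open Scope ring_scope.

(** * Algebraic closure of a subset of a field *)

(** Nothing relates [u] to [eta]: [u] is independent over F only and may be dependent over F<eta>.
    Hence the fresh family [w0] and the return to F<u> by an isomorphism, instead of a modification
    of [u] itself. The delicate point is the transcendence of the derivatives of the modified entry.
    Other monomials of f may also contain y_i^(s), even nonlinearly, so the k-th derivative has the
    form w - c e with e = eta_i^(k+s), where w may involve e too. What w does not involve is the
    undifferentiated coefficient c of y_i^(s); the argument therefore moves c, not e. Fields are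
    subsets of E given by generators, and transcendence degree is a greedy count along a list, so
    towers can be reordered freely. Differential polynomials are syntax compared as functions; E is
    infinite in characteristic 0, which makes this the equality of polynomials. Order and dimension
    of the new ideal both come from the linear growth of the ranks of jets; the dimension is deduced
    from that growth in [dtrdeg_of_growth]. *)

Definition asb (P : Prop) : bool := if excluded_middle_informative P then true else false.

Lemma asbP (P : Prop) : reflect P (asb P).
Proof. by rewrite /asb; case: excluded_middle_informative => h; constructor. Qed.

Section Closure.
Variable E : fieldType.
Implicit Types (X Y : E -> Prop) (a b : E) (l : seq E).

(** [X] is an arbitrary set of generators, so a base field is enlarged just by enlarging a
    predicate. *)
Inductive fld X : E -> Prop :=
| fld_in a of X a : fld X a
| fld1 : fld X 1
| fldB a b of fld X a & fld X b : fld X (a - b)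
| fldM a b of fld X a & fld X b : fld X (a * b)
| fldV a of fld X a : fld X a^-1.

Lemma fld0 X : fld X 0. Proof. by rewrite -(subrr 1); apply: fldB; exact: fld1. Qed.
Lemma fldN X a : fld X a -> fld X (- a).
Proof. by move=> h; rewrite -sub0r; apply: fldB => //; exact: fld0. Qed.
Lemma fldD X a b : fld X a -> fld X b -> fld X (a + b).
Proof. by move=> ha hb; rewrite -[b]opprK; apply: fldB => //; exact: fldN. Qed.

Lemma fldMn X a n : fld X a -> fld X (a *+ n).
Proof. by move=> h; elim: n => [|n IH]; [exact: fld0|rewrite mulrS; exact: fldD]. Qed.
Lemma fldX X a n : fld X a -> fld X (a ^+ n).
Proof. by move=> h; elim: n => [|n IH]; [exact: fld1|rewrite exprS; exact: fldM]. Qed.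
Lemma fld_sum (J : Type) (r : seq J) (P : pred J) (f : J -> E) X :
  (forall j, P j -> fld X (f j)) -> fld X (\sum_(j <- r | P j) f j).
Proof. by move=> h; elim/big_ind: _ => //; [exact: fld0|exact: fldD]. Qed.

Lemma fld_min X (K : E -> Prop) :
  K 1 -> (forall a b, K a -> K b -> K (a - b)) -> (forall a b, K a -> K b -> K (a * b)) ->
  (forall a, K a -> K a^-1) -> (forall a, X a -> K a) -> forall a, fld X a -> K a.
Proof. by move=> k1 kB kM kV kX a; elim=> {a}; auto. Qed.

Lemma fld_mono X Y : (forall a, X a -> fld Y a) -> forall a, fld X a -> fld Y a.
Proof. by move=> h; apply: fld_min => //; [exact: fld1|exact: fldB|exact: fldM|exact: fldV]. Qed.

Definition fldp X : {pred E} := fun a => asb (fld X a).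
Lemma fldpP X a : reflect (fld X a) (a \in fldp X). Proof. exact: asbP. Qed.

Lemma fldp_divring X : divring_closed (fldp X).
Proof.
split; first by apply/fldpP; exact: fld1.
- by move=> a b /fldpP ha /fldpP hb; apply/fldpP; exact: fldB.
- by move=> a b /fldpP ha /fldpP hb; apply/fldpP; apply: fldM => //; exact: fldV.
Qed.
HB.instance Definition _ X := GRing.isDivringClosed.Build E (fldp X) (fldp_divring X).
(** Packaging [fld X] as a field type with its inclusion into [E] gives access to the library theory
    of [algebraicOver]. *)
Definition fldt X : Type := {a : E | a \in fldp X}.
HB.instance Definition _ X := SubType.copy (fldt X) {a : E | a \in fldp X}.
HB.instance Definition _ X := [Choice of fldt X by <:].
HB.instance Definition _ X := [SubChoice_isSubIntegralDomain of fldt X by <:].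
HB.instance Definition _ X := [SubIntegralDomain_isSubField of fldt X by <:].

Definition cl X a := exists p : {poly E}, [/\ p != 0, (forall i, fld X p`_i) & root p a].

Definition fval X : {rmorphism fldt X -> E} := val.
Definition flift X a (h : fld X a) : fldt X := exist _ a (introT (fldpP X a) h).

Lemma lift_poly X (p : {poly E}) : (forall i, fld X p`_i) ->
  exists q : {poly fldt X}, p = map_poly (fval X) q.
Proof.
move=> hp; exists (\poly_(i < size p) flift (hp i)).
apply/polyP=> i; rewrite coef_map coef_poly.
case: ltnP => hi; first by [].
by rewrite nth_default // raddf0.
Qed.

Lemma fval_fld X (z : fldt X) : fld X (fval X z).
Proof. by apply/fldpP; exact: (valP z). Qed.

Lemma clE X a : cl X a <-> algebraicOver (fval X) a.
Proof.
split; first by case=> p [p0 /lift_poly[q def_p] r]; exists q; rewrite -?def_p //;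
  move: p0; rewrite def_p map_poly_eq0.
case=> q q0 r; exists (map_poly (fval X) q); split; rewrite ?map_poly_eq0 //.
by move=> i; rewrite coef_map; exact: fval_fld.
Qed.

Lemma cl_fld X a : fld X a -> cl X a.
Proof.
move=> h; exists ('X - a%:P); split; rewrite ?polyXsubC_eq0 ?root_XsubC //.
move=> i; rewrite coefB coefX coefC; apply: fldB.
  by case: eqP => _; [exact: fld1|exact: fld0].
by case: eqP => _ //; exact: fld0.
Qed.
Lemma cl_in X a : X a -> cl X a. Proof. by move=> h; apply/cl_fld/fld_in. Qed.

Lemma cl1 X : cl X 1. Proof. exact/cl_fld/fld1. Qed.
Lemma clB X a b : cl X a -> cl X b -> cl X (a - b).
Proof. by rewrite !clE; exact: algebraic_sub. Qed.
Lemma clD X a b : cl X a -> cl X b -> cl X (a + b).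
Proof. by rewrite !clE; exact: algebraic_add. Qed.
Lemma clM X a b : cl X a -> cl X b -> cl X (a * b).
Proof. by rewrite !clE; exact: algebraic_mul. Qed.
Lemma clV X a : cl X a -> cl X a^-1.
Proof. by rewrite !clE; exact: algebraic_inv. Qed.
Lemma clN X a : cl X a -> cl X (- a).
Proof. by rewrite !clE; exact: algebraic_opp. Qed.

Lemma clMn X a n : cl X a -> cl X (a *+ n).
Proof.
by move=> h; elim: n => [|n IH]; [exact/cl_fld/fld0|rewrite mulrS; exact: clD].
Qed.
Lemma clX X a n : cl X a -> cl X (a ^+ n).
Proof. by move=> h; elim: n => [|n IH]; [exact: cl1|rewrite exprS; exact: clM]. Qed.

Lemma cl_sum (J : Type) (r : seq J) (P : pred J) (f : J -> E) X :
  (forall j, P j -> cl X (f j)) -> cl X (\sum_(j <- r | P j) f j).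
Proof.
move=> h; elim/big_rec: _ => [|j a Pj ha]; first exact/cl_fld/fld0.
by apply: clD => //; exact: h.
Qed.

Lemma fld_cl X a : fld (cl X) a -> cl X a.
Proof. by apply: fld_min => //; [exact: cl1|exact: clB|exact: clM|exact: clV]. Qed.

(** Over a field algebraic and integral elements coincide, and integrality passes from coefficients
    to roots. This carries the transitivity of [cl]. *)
Lemma cl_root X (p : {poly E}) a : p != 0 -> root p a -> (forall i, cl X p`_i) -> cl X a.
Proof.
move=> p0 ra hp; apply/clE/integral_algebraic.
apply: (integral_root p0 ra) => c /(nthP 0)[i _ <-]; apply/integral_algebraic.
exact/clE.
Qed.

Lemma cl_trans X Y a : (forall b, X b -> cl Y b) -> cl X a -> cl Y a.
Proof.
move=> h [p [p0 hp r]]; apply: cl_root p0 r _ => i; apply: fld_cl.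
by apply: fld_mono (hp i) => b /h hb; exact: fld_in.
Qed.

Lemma cl_mono X Y a : (forall b, X b -> Y b) -> cl X a -> cl Y a.
Proof. by move=> h; apply: cl_trans => b /h; exact: cl_in. Qed.

Definition addx X a : E -> Prop := fun z => X z \/ z = a.
Definition addl X l : E -> Prop := fun z => X z \/ z \in l.

Lemma fld_addx X y a : fld (addx X y) a ->
  exists p q : {poly fldt X}, (map_poly (fval X) q).[y] != 0 /\
    a = (map_poly (fval X) p).[y] / (map_poly (fval X) q).[y].
Proof.
elim=> {a}.
- move=> a [ha|->].
  + exists (flift (fld_in ha))%:P, 1.
    by rewrite rmorph1 !hornerE oner_eq0 divr1 map_polyC hornerC.
  + by exists 'X, 1; rewrite rmorph1 !hornerE oner_eq0 divr1 map_polyX hornerX.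
- by exists 1, 1; rewrite rmorph1 !hornerE oner_eq0 invr1.
- move=> a b _ [p1 [q1 [h1 ->]]] _ [p2 [q2 [h2 ->]]].
  exists (p1 * q2 - p2 * q1), (q1 * q2); rewrite rmorphB !rmorphM hornerD hornerN !hornerM
    mulf_neq0 //.
  by split=> //; rewrite -mulNr addf_div // mulNr.
- move=> a b _ [p1 [q1 [h1 ->]]] _ [p2 [q2 [h2 ->]]].
  exists (p1 * p2), (q1 * q2); rewrite !rmorphM !hornerM mulf_neq0 //.
  by split=> //; rewrite mulf_div.
- move=> a _ [p [q [h ->]]].
  have [p0|p0] := eqVneq (map_poly (fval X) p).[y] 0.
    by exists 0, 1; rewrite p0 mul0r invr0 rmorph0 rmorph1 !hornerE oner_eq0.
  by exists q, p; rewrite invf_div.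
Qed.

Lemma fld_addx_seq X y (n : nat) (c : nat -> E) : (forall i, fld (addx X y) (c i)) ->
  exists (q : {poly fldt X}) (p : nat -> {poly fldt X}), (map_poly (fval X) q).[y] != 0 /\
    forall i, (i < n)%N -> (map_poly (fval X) q).[y] * c i = (map_poly (fval X) (p i)).[y].
Proof.
move=> hc; elim: n => [|n [q [p [hq hp]]]].
  by exists 1, (fun _ => 0); rewrite rmorph1 !hornerE oner_eq0.
have [p1 [q1 [h1 e1]]] := fld_addx (hc n).
exists (q * q1), (fun i => if (i < n)%N then p i * q1 else p1 * q).
rewrite !rmorphM !hornerM mulf_neq0 //; split=> // i; rewrite ltnS => hi.
case: ltnP => hin; rewrite rmorphM hornerM.
  by rewrite mulrAC hp.
have -> : i = n by apply/eqP; rewrite eqn_leq hi hin.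
by rewrite {}e1 -mulrA [X in _ * X = _]mulrC divfK // mulrC.
Qed.

Definition ev2 X (P : {poly {poly fldt X}}) (u v : E) : E :=
  (map_poly (fun p => (map_poly (fval X) p).[u]) P).[v].

Lemma ev2E X (P : {poly {poly fldt X}}) u v :
  ev2 P u v = \sum_(i < size P) (map_poly (fval X) P`_i).[u] * v ^+ i.
Proof.
rewrite /ev2 (@horner_coef_wide _ (size P)) ?size_poly //.
by apply: eq_bigr => i _; rewrite coef_poly ltn_ord.
Qed.

(** Clearing the denominators in [y] leaves a polynomial in two variables over [X], whose roles can
    then be swapped. Nonvanishing is recorded at [y], since a nonzero coefficient of [P] could still
    vanish there. *)
Lemma cl_addxP X y a : cl (addx X y) a ->
  exists P : {poly {poly fldt X}}, ev2 P y a = 0 /\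
    exists i, (map_poly (fval X) P`_i).[y] != 0.
Proof.
case=> p [p0 hp /rootP r].
have [q [c [hq hc]]] := fld_addx_seq (size p) hp.
exists (\poly_(i < size p) c i); split.
  rewrite ev2E (big_ord_widen_cond (size p) xpredT (fun i =>
    (map_poly (fval X) (\poly_(i < size p) c i)`_i).[y] * a ^+ i)) ?size_poly //.
  rewrite big_mkcond /=; transitivity ((map_poly (fval X) q).[y] * p.[a]); last by rewrite r mulr0.
  rewrite (horner_coef p) mulr_sumr.
  apply: eq_bigr => i _; case: ltnP => hi.
    by rewrite coef_poly ltn_ord -hc // mulrA.
  have := nth_default 0 hi; rewrite coef_poly ltn_ord => ci0.
  by rewrite mulrA hc // ci0 rmorph0 horner0 mul0r.
exists (size p).-1; have sp : ((size p).-1 < size p)%N by rewrite prednK // size_poly_gt0.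
by rewrite coef_poly sp -hc // mulf_neq0 // -/(lead_coef p) lead_coef_eq0.
Qed.

(** Steinitz exchange: the relation between [x] and [y] is reread as an equation for [y]. It is
    nontrivial, since otherwise a nonzero column of coefficients would be a polynomial over [X] with
    root [x]. *)
Lemma cl_exchange X x y : cl (addx X y) x -> ~ cl X x -> cl (addx X x) y.
Proof.
move=> /cl_addxP[P [P0 [i hi]]] nx.
(* the coefficients of [Q] in [Y] are the [X]-polynomials read off the columns of [P] *)
pose Q := map_poly (fun p : {poly fldt X} => (map_poly (fval X) p).[x]) (swapXY P).
have fQ k : fld (addx X x) Q`_k.
  rewrite /Q coef_poly; case: ifP => _; last exact: fld0.
  rewrite horner_coef; elim/big_ind: _ => [|a b|j _]; [exact: fld0|exact: fldD|].
  apply: fldM; first by rewrite coef_map; apply: (fld_mono _ (fval_fld _)) => z hz;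
     apply: fld_in; left.
  elim: (nat_of_ord j) => [|m IH]; first exact: fld1.
  by rewrite exprS; apply: fldM => //; apply: fld_in; right.
have Qk k : Q`_k = (map_poly (fval X) (swapXY P)`_k).[x].
  rewrite /Q coef_poly; case: ltnP => // hk.
  by rewrite nth_default // rmorph0 horner0.
exists Q; split=> //.
- have Pi0 : P`_i != 0 by apply: contraNneq hi => ->; rewrite rmorph0 horner0.
  pose j := (size P`_i).-1.
  have Pij : P`_i`_j != 0 by rewrite -/(lead_coef _) lead_coef_eq0.
  apply/eqP=> /(congr1 (fun q : {poly E} => q`_j)); rewrite coef0 Qk => h.
  apply: nx; apply/clE; exists (swapXY P)`_j; last exact/rootP.
  apply: contraNneq Pij => e; move: (coef_swapXY P j i); rewrite e coef0.
  by move=> <-.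
- apply/rootP; rewrite -P0 ev2E.
  rewrite (@horner_coef_wide _ (size (swapXY P))) ?size_poly //.
  have colE (k : nat) : (map_poly (fval X) (swapXY P)`_k).[x] =
      \sum_(l < size P) fval X P`_l`_k * x ^+ l.
    rewrite (@horner_coef_wide _ (size P)).
      by apply: eq_bigr => l _; rewrite coef_map coef_swapXY.
    by rewrite size_map_poly; apply/leq_sizeP => l hl; rewrite coef_swapXY [P`_l]nth_default ?coef0.
  have rowE (l : nat) : (map_poly (fval X) P`_l).[y] =
      \sum_(k < size (swapXY P)) fval X P`_l`_k * y ^+ k.
    rewrite (@horner_coef_wide _ (size (swapXY P))).
      by apply: eq_bigr => k _; rewrite coef_map.
    rewrite size_map_poly; apply/leq_sizeP => k hk.
    by rewrite -coef_swapXY [(swapXY P)`_k]nth_default ?coef0.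
  under eq_bigr => k _ do rewrite Qk colE mulr_suml.
  rewrite exchange_big /=; apply: eq_bigr => l _; rewrite rowE mulr_suml.
  by apply: eq_bigr => k _; rewrite mulrAC.
Qed.

Lemma fld_finitary X Y a : fld (fun z => X z \/ Y z) a ->
  exists l, (forall z, z \in l -> Y z) /\ fld (addl X l) a.
Proof.
have mono l1 l2 b : {subset l1 <= l2} -> fld (addl X l1) b -> fld (addl X l2) b.
  by move=> s; apply: fld_mono => z [hz|/s hz]; apply: fld_in; [left|right].
elim=> {a}.
- move=> a [ha|ha]; first by exists [::]; split=> //; apply: fld_in; left.
  exists [:: a]; split; first by move=> z; rewrite inE => /eqP->.
  by apply: fld_in; right; rewrite inE.
- by exists [::]; split=> //; exact: fld1.
- move=> a b _ [l1 [h1 f1]] _ [l2 [h2 f2]]; exists (l1 ++ l2); split.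
    by move=> z; rewrite mem_cat => /orP[/h1|/h2].
  by apply: fldB; [apply: mono f1|apply: mono f2] => z hz; rewrite mem_cat hz ?orbT.
- move=> a b _ [l1 [h1 f1]] _ [l2 [h2 f2]]; exists (l1 ++ l2); split.
    by move=> z; rewrite mem_cat => /orP[/h1|/h2].
  by apply: fldM; [apply: mono f1|apply: mono f2] => z hz; rewrite mem_cat hz ?orbT.
- by move=> a _ [l [h f]]; exists l; split=> //; exact: fldV.
Qed.

(** Bases with infinitely many adjoined elements occur throughout, while ranks concern finite lists;
    one algebraic equation involves only finitely many elements. *)
Lemma cl_finitary X Y a : cl (fun z => X z \/ Y z) a ->
  exists l, (forall z, z \in l -> Y z) /\ cl (addl X l) a.
Proof.
case=> p [p0 hp r].
suff [l [hl fl]] : exists l, (forall z, z \in l -> Y z) /\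
    forall i, (i < size p)%N -> fld (addl X l) p`_i.
  exists l; split=> //; exists p; split=> // i; case: (ltnP i (size p)) => [/fl//|hi].
  by rewrite nth_default //; exact: fld0.
elim: (size p) => [|n [l [hl fl]]]; first by exists [::].
have [l2 [h2 f2]] := fld_finitary (hp n).
exists (l ++ l2); split; first by move=> z; rewrite mem_cat => /orP[/hl|/h2].
move=> i; rewrite ltnS leq_eqVlt => /orP[/eqP->|/fl].
  by apply: fld_mono f2 => z [|] hz; apply: fld_in; [left|right; rewrite mem_cat hz orbT].
by apply: fld_mono => z [|] hz; apply: fld_in; [left|right; rewrite mem_cat hz].
Qed.

End Closure.

(** * Transcendence degree *)

Section Rank.
Variable E : fieldType.
Implicit Types (X Y : E -> Prop) (a b : E) (l : seq E).

Lemma addx_cl X Y a z : (forall b, X b -> cl Y b) -> addx X a z -> cl (addx Y a) z.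
Proof.
move=> h [/h|->]; last by apply: cl_in; right.
by apply: cl_mono => b; left.
Qed.

(* [rk X l] is the transcendence degree of [X(l)] over [X], counted greedily. *)
Fixpoint rk X l : nat :=
  if l is a :: l' then (~~ asb (cl X a) + rk (addx X a) l')%N else 0%N.

Lemma rk_anti X Y l : (forall b, X b -> cl Y b) -> (rk Y l <= rk X l)%N.
Proof.
elim: l X Y => //= a l IH X Y h; apply: leq_add; last first.
  by apply: IH => b; exact: addx_cl.
by case: (asbP (cl X a)) => [/(cl_trans h)|_]; case: asbP.
Qed.

Lemma rk_eq X Y l : (forall b, X b -> cl Y b) -> (forall b, Y b -> cl X b) -> rk X l = rk Y l.
Proof. by move=> h1 h2; apply/eqP; rewrite eqn_leq !rk_anti. Qed.

Lemma rk_cat X l1 l2 : rk X (l1 ++ l2) = (rk X l1 + rk (addl X l1) l2)%N.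
Proof.
elim: l1 X => [|a l1 IH] X /=.
  by apply: rk_eq => b; [move=> h; apply: cl_in; left|case=> // h; exact: cl_in].
rewrite IH addnA; congr addn; apply: rk_eq => b.
  case=> [[h|->]|h]; apply: cl_in; [by left| |]; by right; rewrite inE ?eqxx // h orbT.
case=> [h|]; first by apply: cl_in; do 2 left.
by rewrite inE => /orP[/eqP->|h]; apply: cl_in; [left; right|right].
Qed.

Lemma cl_addx_id X a b : cl X a -> cl (addx X a) b -> cl X b.
Proof. by move=> ha; apply: cl_trans => z [/cl_in|->]. Qed.

Lemma cl_addx X a b : cl X b -> cl (addx X a) b.
Proof. by apply: cl_mono => z; left. Qed.

(** This is where the rank relies on the exchange lemma; invariance under permutations, and with it
    every count of a rank in two orders, follows formally. *)
Lemma rk_swap X a b l : rk X (a :: b :: l) = rk X (b :: a :: l).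
Proof.
rewrite /= !addnA; congr addn; last first.
  by apply: rk_eq => z [[h|->]|->]; apply: cl_in; rewrite /addx; auto.
case: (asbP (cl X a)) => ha; case: (asbP (cl X b)) => hb;
  case: (asbP (cl (addx X a) b)) => hab; case: (asbP (cl (addx X b) a)) => hba //.
all: exfalso; first [exact: hba (cl_addx _ ha) | exact: hab (cl_addx _ hb)
  | exact: hb (cl_addx_id ha hab) | exact: ha (cl_addx_id hb hba)
  | exact: hba (cl_exchange hab hb) | exact: hab (cl_exchange hba ha)].
Qed.

Lemma rk_front X l1 a l2 : rk X (l1 ++ a :: l2) = rk X (a :: l1 ++ l2).
Proof.
elim: l1 X => //= b l1 IH X; rewrite IH -/(rk X (b :: a :: l1 ++ l2)) rk_swap //.
Qed.

Lemma rk_perm X l1 l2 : perm_eq l1 l2 -> rk X l1 = rk X l2.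
Proof.
elim: l1 l2 X => [|a l1 IH] l2 X h.
  by move: h; rewrite perm_sym => /perm_nilP->.
have : a \in l2 by rewrite -(perm_mem h) mem_head.
case/splitPr def_l2: l2 / => [s1 s2].
rewrite rk_front /=; congr addn; apply: IH.
by rewrite -(perm_cons a) (perm_trans h) // def_l2 -[a :: s2]cat1s perm_catCA.
Qed.

Lemma rk_le_size X l : (rk X l <= size l)%N.
Proof. by elim: l X => //= a l IH X; rewrite -add1n leq_add // leq_b1. Qed.

Lemma rk0P X l : rk X l = 0%N <-> forall a, a \in l -> cl X a.
Proof.
elim: l X => [|a l IH] X /=; first by split.
split.
  case: (asbP (cl X a)) => //= ha; rewrite add0n => /IH h b.
  by rewrite inE => /orP[/eqP->//|/h]; exact: cl_addx_id.
move=> h; case: (asbP (cl X a)) => [ha|[]]; last by apply: h; rewrite mem_head.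
by rewrite add0n; apply/IH => b hb; apply/cl_addx/h; rewrite inE hb orbT.
Qed.

Lemma rk_sub X l l' : (forall a, a \in l -> cl (addl X l') a) -> (rk X l <= rk X l')%N.
Proof.
move=> /rk0P h; have := rk_cat X l' l; rewrite h addn0 => <-.
by rewrite (rk_perm X (permEl (perm_catC l' l))) rk_cat leq_addr.
Qed.

Lemma rk_subset X l l' : {subset l <= l'} -> (rk X l <= rk X l')%N.
Proof. by move=> h; apply: rk_sub => a /h ha; apply: cl_in; right. Qed.

Lemma rk_cat_le X l1 l2 : (rk X (l1 ++ l2) <= rk X l1 + rk X l2)%N.
Proof. by rewrite rk_cat leq_add2l rk_anti // => b hb; apply: cl_in; left. Qed.

Lemma rk_basis X l : exists t, [/\ subseq t l, rk X t = size t & size t = rk X l].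
Proof.
elim: l X => [|a l IH] X /=; first by exists [::].
have [t [s1 r1 e1]] := IH (addx X a).
case: (asbP (cl X a)) => ha.
  exists t; rewrite add0n -e1; split=> //.
    exact: (subseq_trans s1 (subseq_cons l a)).
  rewrite -r1; apply: rk_eq => b; first by move=> h; apply: cl_in; left.
  by case=> [/cl_in|->].
exists (a :: t); rewrite /= eqxx s1 r1 e1; split=> //.
by case: asbP.
Qed.

(** Complete [idx] to a rearrangement of [big]: the ranks of the two pieces are bounded by their
    lengths and add up to the full length, so both bounds are equalities. *)
Lemma rk_sub_indep X (T : eqType) (x : T -> E) (idx big : seq T) :
  uniq idx -> {subset idx <= big} -> rk X (map x big) = size big ->
  rk X (map x idx) = size idx.
Proof.
move=> u s h.
have : exists r, perm_eq big (idx ++ r).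
  have /count_subseqP[t /perm_to_subseq[r p] q] :
      forall y, (count_mem y idx <= count_mem y big)%N.
    move=> y; rewrite (count_uniq_mem _ u); case: (boolP (y \in idx)) => // /s.
    by rewrite -has_pred1 has_count.
  by exists r; rewrite (perm_trans p) // perm_cat2r perm_sym.
case=> r p; move: h; rewrite (perm_size p) (rk_perm X (perm_map x p)) map_cat rk_cat size_cat.
have := rk_le_size X (map x idx); have := rk_le_size (addl X (map x idx)) (map x r).
rewrite !size_map => h1 h2 e; apply/eqP; rewrite eqn_leq h2 /=.
by rewrite -(leq_add2r (size r)) -e leq_add2l.
Qed.

Definition extx X (T : Type) (x : T -> E) (A : T -> Prop) : E -> Prop :=
  fun z => X z \/ exists2 t, A t & z = x t.

Lemma extx_finitary (T : eqType) X (x : T -> E) A a : cl (extx X x A) a ->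
  exists idx, [/\ uniq idx, (forall t, t \in idx -> A t) & cl (addl X (map x idx)) a].
Proof.
case/cl_finitary=> l [hl ha].
suff [idx [h1 h2]] : exists idx : seq T, (forall t, t \in idx -> A t) /\ l = map x idx.
  exists (undup idx); rewrite undup_uniq; split=> //.
    by move=> t; rewrite mem_undup; exact: h1.
  apply: cl_mono ha => z [|]; first by left.
  by rewrite h2 => /mapP[t ht ->]; right; rewrite map_f // mem_undup.
elim: l hl {ha} => [|z l IH] hl; first by exists [::].
have [t At ez] := hl z (mem_head _ _).
have [|idx [h1 h2]] := IH; first by move=> w hw; apply: hl; rewrite inE hw orbT.
by exists (t :: idx); rewrite /= -ez h2; split=> // t'; rewrite inE => /orP[/eqP->|/h1].
Qed.

(** Independence of a possibly infinite family, tested on finite lists of distinct indices; a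
    repeated value thus counts as a dependence. *)
Definition findep (T : eqType) X (x : T -> E) : Prop :=
  forall idx, uniq idx -> rk X (map x idx) = size idx.

Section Findep.
Variables (T : eqType) (G : E -> Prop) (x : T -> E).
Hypothesis indep : findep G x.

Lemma findep_anti X : (forall b, X b -> cl G b) -> findep X x.
Proof.
move=> h idx /indep e; apply/eqP; rewrite eqn_leq -{1}(size_map x) rk_le_size /=.
by rewrite -e rk_anti.
Qed.

(** Count the rank of finitely many [x] together with [a] over [X] in two orders. If [a] became
    algebraic only after adjoining these [x], they would lose rank over [X(a)], although they are
    independent even over [G], over which [a] is algebraic. *)
Lemma findep_cl (X : E -> Prop) A a : (forall b, X b -> cl G b) -> cl G a ->
  cl (extx X x A) a -> cl X a.
Proof.
move=> hX ha /extx_finitary[idx [u _ h]].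
have := rk_front X (map x idx) a [::]; rewrite cats0 rk_cat /=.
case: asbP => // _; rewrite addn0 (findep_anti hX u).
case: (asbP (cl X a)) => // _ /=.
have := rk_anti (X := addx X a) (Y := G) (map x idx); rewrite indep //.
move=> h1 h2; suff : (size idx < size idx)%N by rewrite ltnn.
by rewrite -{2}[size idx]addn0 h2 add1n ltnS; apply: h1 => b [/hX|->].
Qed.

Lemma findep_notin A t : ~ A t -> ~ cl (extx G x A) (x t).
Proof.
move=> nA /extx_finitary[idx [u hA h]].
have : uniq (t :: idx) by rewrite /= u andbT; apply/negP => /hA.
move/indep; rewrite /= -/(rk G (x t :: map x idx)) -[map x idx]cats0 -rk_front.
rewrite rk_cat /= indep //; case: asbP => // _ e.
by move/eqP: e; rewrite addn0 -addn1 eqn_add2l.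
Qed.

Lemma findep_rk (X : E -> Prop) A l : (forall b, X b -> cl G b) ->
  (forall a, a \in l -> cl G a) -> rk (extx X x A) l = rk X l.
Proof.
elim: l X => //= a l IH X hX hl.
have ha : cl G a by apply: hl; rewrite mem_head.
congr addn.
  case: (asbP (cl (extx X x A) a)) => h1; case: (asbP (cl X a)) => h2 //; exfalso.
    by apply: h2; exact: findep_cl h1.
  by apply: h1; apply: cl_mono h2 => z; left.
rewrite -(IH (addx X a)).
- apply: rk_eq => b.
    by case=> [[h|h]|->]; apply: cl_in; [left; left|right|left; right].
  by case=> [[h|->]|h]; apply: cl_in; [left; left|right|left; right].
- by move=> b [/hX|->].
- by move=> b hb; apply: hl; rewrite inE hb orbT.
Qed.

End Findep.

(** Triangular situation: each [v j] is new over level [j] of a tower and absorbed at level [j.+1],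
    so each raises the rank by one. In the applications [v] lists the successive derivatives of one
    element. *)
Lemma chain_rk (Y : nat -> E -> Prop) (v : nat -> E) (X : E -> Prop) k N :
  (forall j, (j < k + N)%N -> ~ cl (Y j) (v j)) ->
  (forall i j b, (i <= j)%N -> Y i b -> Y j b) ->
  (forall j, cl (Y j.+1) (v j)) -> (forall b, X b -> cl (Y k) b) ->
  rk X (map v (iota k N)) = N.
Proof.
move=> h1 h2 h3; elim: N k X h1 => //= N IH k X h1 hX.
rewrite IH; first by case: asbP => // /(cl_trans hX); case/h1; rewrite addnS ltnS leq_addr.
  by move=> j hj; apply: h1; rewrite addnS -addSn.
move=> b [/hX|->]; last exact: h3.
by apply: cl_mono => z; exact: h2.
Qed.

(** The offset [k] serves when the first [k] elements have already been absorbed into the base. *)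
Lemma chain_findep (Y : nat -> E -> Prop) (v : nat -> E) (X : E -> Prop) k :
  (forall j, ~ cl (Y j) (v j)) -> (forall i j b, (i <= j)%N -> Y i b -> Y j b) ->
  (forall j, cl (Y j.+1) (v j)) -> (forall b, X b -> cl (Y k) b) ->
  findep X (fun j => v (k + j)%N).
Proof.
move=> h1 h2 h3 hX idx u; apply: (rk_sub_indep (big := iota 0 (\max_(i <- idx) i).+1)) => //.
  by move=> i hi; rewrite mem_iota /= add0n ltnS (@leq_bigmax_seq _ idx xpredT id).
rewrite size_iota -[RHS](chain_rk (fun j _ => h1 j) h2 h3 hX).
by rewrite -[in RHS](addn0 k) iotaDl -map_comp.
Qed.

End Rank.

(** * Derivations on generated subfields and on their algebraic closures *)

Section Derivation.
Variables (E : fieldType) (D : E -> E).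
Hypothesis derD : is_derivation D.
Implicit Types (X Y : E -> Prop) (a b : E).

Lemma derA a b : D (a + b) = D a + D b. Proof. by case: derD. Qed.
Lemma derM a b : D (a * b) = D a * b + a * D b. Proof. by case: derD. Qed.
Lemma der0 : D 0 = 0.
Proof. by apply: (addrI (D 0)); rewrite -derA !addr0. Qed.
Lemma der1 : D 1 = 0.
Proof. by apply: (addrI (D 1)); rewrite addr0 -{3}(mulr1 1) derM mulr1 mul1r. Qed.
Lemma derN a : D (- a) = - D a.
Proof. by apply/eqP; rewrite -addr_eq0 -derA addNr der0. Qed.
Lemma derB a b : D (a - b) = D a - D b.
Proof. by rewrite derA derN. Qed.
Lemma derV a : D a^-1 = - (D a * a^-1 * a^-1).
Proof.
have [->|a0] := eqVneq a 0; first by rewrite invr0 der0 !mulr0 oppr0.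
apply: (mulfI a0); apply: (addrI (D a * a^-1)); rewrite -derM divff // der1.
by rewrite mulrN [a * _]mulrC divfK // subrr.
Qed.
Lemma derX a n : D (a ^+ n) = a ^+ n.-1 *+ n * D a.
Proof.
elim: n => [|n IH]; first by rewrite expr0 der1 mulr0n mul0r.
rewrite exprS derM IH; case: n {IH} => [|n];
  first by rewrite mulr0n mul0r mulr0 addr0 mulr1n expr0 mulrC.
by rewrite [D a * _]mulrC mulrA mulrnAr -exprS [in RHS]mulrS mulrDl.
Qed.
Lemma der_sum (J : Type) (r : seq J) (P : pred J) (f : J -> E) :
  D (\sum_(j <- r | P j) f j) = \sum_(j <- r | P j) D (f j).
Proof. by apply: big_morph; [exact: derA|exact: der0]. Qed.
Lemma iterD_add k a b : iter k D (a + b) = iter k D a + iter k D b.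
Proof. by elim: k => //= k ->; rewrite derA. Qed.
Lemma iterD_opp k a : iter k D (- a) = - iter k D a.
Proof. by elim: k => //= k ->; rewrite derN. Qed.
Lemma iterD0 k : iter k D 0 = 0.
Proof. by elim: k => //= k ->; rewrite der0. Qed.

(** Two predicates, because differentiating raises the order of jets by one level. *)
Lemma fld_der X Y a : (forall b, X b -> fld Y b) -> (forall b, X b -> fld Y (D b)) ->
  fld X a -> fld Y (D a).
Proof.
move=> h1 h2; have h b := fld_mono h1 (a := b).
elim=> {a}.
- by move=> a; exact: h2.
- by rewrite der1; exact: fld0.
- by move=> a b _ ha _ hb; rewrite derB; exact: fldB.
- by move=> a b fa ha fb hb; rewrite derM; apply: fldD; apply: fldM => //; exact: h.
- move=> a fa ha; rewrite derV; apply: fldN; apply: fldM; first apply: fldM => //;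
    apply: fldV; exact: h.
Qed.

Hypothesis pchar0 : [pchar E] =i pred0.

Lemma der_horner (p : {poly E}) a :
  D p.[a] = (\poly_(i < size p) D p`_i).[a] + p^`().[a] * D a.
Proof.
rewrite (horner_coef p) der_sum horner_poly.
have -> : p^`().[a] = \sum_(i < size p) p`_i * (a ^+ i.-1 *+ i).
  rewrite (horner_coef_wide (n := (size p).-1)); last first.
    exact: leq_trans (size_poly _ _) (leqnn _).
  case: (size p) => [|n] /=; first by rewrite !big_ord0.
  rewrite big_ord_recl /= mulr0n mulr0 add0r; apply: eq_bigr => i _.
  by rewrite coef_deriv /bump add1n /= mulrnAl mulrnAr.
rewrite mulr_suml -big_split /=; apply: eq_bigr => i _.
by rewrite derM derX mulrA.
Qed.

(* A zero of a polynomial of least degree is not a zero of its derivative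
   (characteristic 0), so differentiating the equation expresses [D a]. *)
Lemma cl_der X Y a : (forall b, X b -> fld Y b) -> (forall b, X b -> fld Y (D b)) ->
  cl X a -> cl Y (D a).
Proof.
move=> h1 h2 ca; have ca' : cl Y a by apply: cl_trans ca => b /h1/cl_fld.
case: ca => p; move: {2}(size p) (leqnn (size p)) => n; elim: n p => [|n IH] p hn [p0 hp r].
  by move: p0; rewrite -size_poly_gt0 ltnNge hn.
have cp i : cl Y p`_i by apply: cl_fld; apply: fld_mono (hp i).
have [d0|d0] := eqVneq p^`().[a] 0.
  apply: (IH p^`()).
    by rewrite -ltnS; apply: leq_trans hn; exact: lt_size_deriv.
  split; last exact/rootP.
  - apply: contraTneq r => e.
    have -> : p = (p`_0)%:P.
      apply/polyP=> -[|i]; rewrite coefC //=; have := coef_deriv p i; rewrite e coef0.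
      move/eqP; rewrite eq_sym -mulr_natr mulf_eq0 ((pcharf0P E).1 pchar0) orbF.
      by move/eqP.
    rewrite rootC; apply: contraNneq p0 => c0; apply/eqP/polyP=> -[|i]; rewrite coef0 //.
    have := coef_deriv p i; rewrite e coef0.
    by move/eqP; rewrite eq_sym -mulr_natr mulf_eq0 ((pcharf0P E).1 pchar0) orbF => /eqP.
  - by move=> i; rewrite coef_deriv; apply: fldMn.
have := der_horner p a; rewrite (rootP r) der0 => /esym/eqP; rewrite addr_eq0 => /eqP e.
have -> : D a = - (\poly_(i < size p) D p`_i).[a] / p^`().[a].
  by rewrite e opprK mulrAC divff // mul1r.
apply: clM; last first.
  by apply: clV; rewrite horner_coef; apply: cl_sum => i _; rewrite coef_deriv;
    apply: clM; [exact: clMn|exact: clX].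
apply: clN; rewrite horner_poly; apply: cl_sum => i _; apply: clM; last exact: clX.
by apply: cl_fld; apply: fld_der (hp i).
Qed.

End Derivation.

(** * Algebraic independence *)

Section AlgIndep.
Variable E : fieldType.
Hypothesis pchar0 : [pchar E] =i pred0.

(** In characteristic 0 the natural numbers below [size p] are distinct elements of [E], too many to
    be roots of a nonzero [p]. *)
Lemma poly_ext0 (p : {poly E}) : (forall t, p.[t] = 0) -> p = 0.
Proof.
move=> h; apply/eqP; apply: contraT => p0.
have := @max_poly_roots _ p [seq i%:R | i <- iota 0 (size p)] p0.
rewrite size_map size_iota ltnn; apply; first by apply/allP => t _; apply/rootP.
rewrite map_inj_uniq ?iota_uniq // => i j /eqP.
wlog le_ij : i j / (i <= j)%N.
  by move=> W; case/orP: (leq_total i j) => [/W//|/W h'] /eqP/esym/eqP/h'.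
rewrite eq_sym -subr_eq0 -natrB // ((pcharf0P E).1 pchar0) subn_eq0 => le_ji.
by apply/eqP; rewrite eqn_leq le_ij.
Qed.

(** [low] and [ext] split the last variable off an assignment, in accordance with [muni], which
    views a polynomial in n + 1 variables as univariate in the last one. *)
Definition low n (v : 'I_n.+1 -> E) : 'I_n -> E := v \o widen_ord (leqnSn n).

Definition ext n (w : 'I_n -> E) (t : E) (i : 'I_n.+1) : E :=
  if unlift ord_max i is Some j then w j else t.

Lemma low_ext n (w : 'I_n -> E) t : low (ext w t) =1 w.
Proof.
move=> i; rewrite /low /ext /=.
have -> : widen_ord (leqnSn n) i = lift ord_max i.
  by apply/val_inj; rewrite /= /bump leqNgt ltn_ord.
by rewrite liftK.
Qed.

Lemma ext_max n (w : 'I_n -> E) t : ext w t ord_max = t.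
Proof. by rewrite /ext unlift_none. Qed.

Lemma meval_mwiden n (p : {mpoly E[n]}) w : (mwiden p).@[w] = p.@[low w].
Proof.
rewrite /mwiden /mmap rmorph_sum mevalE; apply: eq_bigr => m _ /=.
rewrite mevalM mevalC /mmap1 rmorph_prod; congr (_ * _).
by apply: eq_bigr => i _; rewrite rmorphXn /= mevalXU.
Qed.

Lemma mwiden_over n (p : {mpoly E[n]}) (S : subringClosed E) :
  p \is a mpolyOver n S -> mwiden p \is a mpolyOver n.+1 S.
Proof.
move=> hp; rewrite /mwiden /mmap rpred_sum // => m _.
rewrite rpredM ?mpolyOverC ?(mpolyOverP _ hp) //.
by rewrite rpred_prod // => i _; rewrite rpredX // mpolyOverX.
Qed.

Lemma meval_muni n (p : {mpoly E[n.+1]}) (v : 'I_n.+1 -> E) :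
  p.@[v] = (map_poly (meval (low v)) (muni p)).[v ord_max].
Proof.
rewrite muniE mevalE rmorph_sum horner_sum; apply: eq_bigr => m _.
rewrite /= map_polyZ map_polyXn hornerZ hornerXn /= mevalZ mevalX -mulrA.
rewrite big_ord_recr /=; congr (_ * (_ * _)).
by apply: eq_bigr => i _; rewrite mnmE.
Qed.

Lemma muni_eq0 n (p : {mpoly E[n.+1]}) : muni p = 0 -> p = 0.
Proof.
move=> h; apply/mpolyP => m; rewrite mcoeff0.
have [hm|hm] := boolP (m \in msupp p); last exact: memN_msupp_eq0.
have := congr1 (fun q : {poly {mpoly E[n]}} =>
  (q`_(m ord_max))@_[multinom m (widen_ord (leqnSn n) i) | i < n]) h.
rewrite coef0 mcoeff0 muniE coef_sum raddf_sum /= (bigD1_seq m) ?msupp_uniq //=.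
rewrite coefZ coefXn eqxx mulr1 mcoeffZ mcoeffX eqxx mulr1 big1 ?addr0 // => m' ne.
rewrite coefZ coefXn; case: eqP => [e|_]; last by rewrite mulr0 mcoeff0.
rewrite mulr1 mcoeffZ mcoeffX; case: eqP => [e'|_]; last by rewrite mulr0.
case/negP: ne; apply/eqP/mnmP => i.
have [lt_in|ge_in] := ltnP i n.
  have -> : i = widen_ord (leqnSn n) (Ordinal lt_in) by apply: val_inj.
  by have := congr1 (fun m : 'X_{1..n} => m (Ordinal lt_in)) e'; rewrite !mnmE.
have -> // : i = ord_max.
by apply/val_inj/eqP; rewrite eqn_leq ge_in -ltnS ltn_ord.
Qed.

(** This is what makes the extensional [dp_eq] agree with equality of polynomials; induction on the
    number of variables reduces it to the univariate case. *)
Lemma mpoly_ext0 n (p : {mpoly E[n]}) : (forall v, p.@[v] = 0) -> p = 0.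
Proof.
elim: n p => [|n IH] p h.
  apply/mpolyP => m; rewrite mcoeff0; have := h (fun=> 0).
  have e0 (m' : 'X_{1..0}) : m' = 0%MM by apply/mnmP => -[].
  rewrite mevalE => e.
  have [hm|hm] := boolP (m \in msupp p); last exact: memN_msupp_eq0.
  move: e; rewrite (bigD1_seq m) ?msupp_uniq //= [X in _ + X]big1 ?addr0; last first.
    by move=> m'; rewrite (e0 m) (e0 m') eqxx.
  by rewrite big_ord0 mulr1.
apply: muni_eq0; apply/polyP => k; rewrite coef0; apply: IH => w.
suff e0 : map_poly (meval w) (muni p) = 0 by have := coef_map (meval w) (muni p) k;
  rewrite e0 coef0.
apply: poly_ext0 => t; have := h (ext w t); rewrite meval_muni ext_max => <-.
by congr (_.[_]); apply: eq_map_poly => q; apply: meval_eq => i; rewrite low_ext.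
Qed.

Variable K : E -> Prop.

Definition vset n (v : 'I_n -> E) : E -> Prop := addl K (map v (enum 'I_n)).

Lemma mpolyOver_evalP n (p : {mpoly E[n]}) (v : 'I_n -> E) (X : E -> Prop) :
  (forall m, fld X p@_m) -> (forall i, fld X (v i)) -> fld X p.@[v].
Proof.
move=> hp hv; rewrite mevalE; apply: fld_sum => m _; apply: fldM => //.
by elim/big_ind: _ => [|a b|i _]; [exact: fld1|exact: fldM|exact: fldX].
Qed.

Lemma fld_mpoly n (v : 'I_n -> E) z : fld (vset v) z ->
  exists p q : {mpoly E[n]}, [/\ p \is a mpolyOver n (fldp K), q \is a mpolyOver n (fldp K),
    q.@[v] != 0 & z = p.@[v] / q.@[v]].
Proof.
elim=> {z}.
- move=> a [ha|/mapP[i _ ->]].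
    exists a%:MP, 1; rewrite meval1 mevalC oner_eq0 divr1 rpred1 mpolyOverC; split=> //.
    by apply/fldpP; exact: fld_in.
  by exists 'X_i, 1; rewrite meval1 mevalXU oner_eq0 divr1 rpred1 mpolyOverX.
- by exists 1, 1; rewrite meval1 rpred1 oner_eq0 invr1 mulr1.
- move=> a b _ [p1 [q1 [h1 g1 n1 ->]]] _ [p2 [q2 [h2 g2 n2 ->]]].
  exists (p1 * q2 - p2 * q1), (q1 * q2); rewrite mevalB !mevalM mulf_neq0 //.
  by split; rewrite ?rpredB ?rpredM // -mulNr addf_div // mulNr.
- move=> a b _ [p1 [q1 [h1 g1 n1 ->]]] _ [p2 [q2 [h2 g2 n2 ->]]].
  exists (p1 * p2), (q1 * q2); rewrite !mevalM mulf_neq0 //.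
  by split; rewrite ?rpredM // mulf_div.
- move=> a _ [p [q [h g nq ->]]].
  have [p0|p0] := eqVneq p.@[v] 0.
    by exists 0, 1; rewrite p0 mul0r invr0 meval0 meval1 mul0r oner_eq0 rpred0 rpred1.
  by exists q, p; rewrite invf_div.
Qed.

Lemma fld_mpoly_seq n (v : 'I_n -> E) (N : nat) (c : nat -> E) :
  (forall i, fld (vset v) (c i)) ->
  exists (q : {mpoly E[n]}) (p : nat -> {mpoly E[n]}),
    [/\ q.@[v] != 0, (forall i, p i \is a mpolyOver n (fldp K)) &
    forall i, (i < N)%N -> q.@[v] * c i = (p i).@[v]].
Proof.
move=> hc.
suff [q [p [hq q0 hp hqp]]] : exists (q : {mpoly E[n]}) (p : nat -> {mpoly E[n]}),
  [/\ q \is a mpolyOver n (fldp K), q.@[v] != 0, (forall i, p i \is a mpolyOver n (fldp K)) &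
    forall i, (i < N)%N -> q.@[v] * c i = (p i).@[v]] by exists q, p.
elim: N => [|N [q [p [hq q0 hp e]]]].
  by exists 1, (fun=> 0); split; rewrite ?meval1 ?oner_eq0 ?rpred1 // => i; rewrite rpred0.
have [p1 [q1 [h1 g1 n1 e1]]] := fld_mpoly (hc N).
exists (q * q1), (fun i => if (i < N)%N then p i * q1 else p1 * q).
rewrite mevalM mulf_neq0 ?rpredM //; split=> // i.
  by case: ifP; rewrite ?rpredM.
rewrite ltnS => hi; case: ltnP => hin; rewrite mevalM; first by rewrite mulrAC e.
have -> : i = N by apply/eqP; rewrite eqn_leq hi hin.
by rewrite {}e1 -mulrA [X in _ * X = _]mulrC divfK // mulrC.
Qed.

Definition aindep n (v : 'I_n -> E) : Prop :=
  forall p : {mpoly E[n]}, p \is a mpolyOver n (fldp K) -> p.@[v] = 0 -> p = 0.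

(** Links independence stated by polynomials to the greedy rank. In both, independence of n + 1
    values amounts to independence of the first n and transcendence of the last over them. *)
Lemma aindep_rk n (v : 'I_n -> E) : aindep v <-> rk K (map v (enum 'I_n)) = n.
Proof.
elim: n v => [|n IH] v.
  rewrite (size0nil (size_enum_ord 0)) /=; split=> // _ p _; rewrite mevalE.
  move=> e; apply: mpoly_ext0 => w; rewrite -e mevalE; apply: eq_bigr => m _.
  by rewrite !big_ord0.
have defs : map v (enum 'I_n.+1) = map (low v) (enum 'I_n) ++ [:: v ord_max].
  rewrite enum_ordSr map_rcons -cats1 -map_comp; congr (_ ++ _).
have rkE : rk K (map v (enum 'I_n.+1)) = n.+1 <->
    rk K (map (low v) (enum 'I_n)) = n /\ ~ cl (vset (low v)) (v ord_max).
  rewrite defs rk_cat /=; have := rk_le_size K (map (low v) (enum 'I_n)).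
  rewrite size_map size_enum_ord /vset => le_n; case: asbP => h /=; rewrite addn0.
    by rewrite addn0; split=> [e|[]//]; move: le_n; rewrite e ltnn.
  by rewrite addn1; split=> [[]|[->]].
rewrite rkE -IH; split.
- move=> h; split.
  + move=> p hp p0.
    have e : mwiden p = 0 by apply: h; [exact: mwiden_over|rewrite meval_mwiden].
    apply: mpoly_ext0 => w.
    by rewrite -(meval_eq _ (low_ext w 0)) -meval_mwiden e meval0.
  + case=> q [q0 hq /rootP r].
    have [d [c [hd hc e]]] := fld_mpoly_seq (size q) hq.
    (* Multiplying [q] by the common denominator [d] and writing the numerators as polynomials in
       the other variables gives a relation over [K] among all the values. *)
    pose P := \sum_(i < size q) mwiden (c i) * 'X_ord_max ^+ i.
    have evP w : low w =1 low v -> P.@[w] = d.@[low v] * q.[w ord_max].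
      move=> ew; rewrite /P rmorph_sum horner_coef mulr_sumr; apply: eq_bigr => i _ /=.
      by rewrite rmorphM rmorphXn /= mevalXU meval_mwiden (meval_eq _ ew) -e // mulrA.
    have P0 : P = 0.
      apply: h; last by rewrite evP // r mulr0.
      by rewrite rpred_sum // => i _; rewrite rpredM ?rpredX ?mpolyOverX ?mwiden_over.
    case/eqP: q0; apply: poly_ext0 => t.
    have := evP _ (low_ext (low v) t); rewrite P0 meval0 ext_max => /esym/eqP.
    by rewrite mulf_eq0 (negPf hd) => /eqP.
- case=> h nc p hp p0.
  have hk k : (muni p)`_k \is a mpolyOver n (fldp K).
    rewrite muniE coef_sum rpred_sum // => m _; rewrite coefZ coefXn.
    rewrite rpredM ?rpred_nat // -mul_mpolyC rpredM ?mpolyOverC ?mpolyOverX //.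
    exact: (mpolyOverP _ hp).
  (* Read in its last variable, [p] either gives an equation for the last value or has coefficients
     that all vanish at the earlier values. *)
  have [q0|q0] := eqVneq (map_poly (meval (low v)) (muni p)) 0; last first.
    case: nc; exists (map_poly (meval (low v)) (muni p)); split=> //.
      move=> i; rewrite coef_map; apply: mpolyOver_evalP.
        move=> m; have /fldpP := mpolyOverP _ (hk i) m; apply: fld_mono => z hz.
        by apply: fld_in; left.
      by move=> j; apply: fld_in; right; rewrite map_f // mem_enum.
    by apply/rootP; rewrite -meval_muni.
  apply: muni_eq0; apply/polyP => k; rewrite coef0; apply: h => //.
  by rewrite -(coef_map (meval (low v))) q0 coef0.
Qed.

Hypothesis Ksub : forall a, fld K a -> K a.

Lemma alg_indepP (x : seq E) : alg_indep K x <-> rk K x = size x.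
Proof.
have {2}-> : x = map (fun i : 'I_(size x) => x`_i) (enum 'I_(size x)).
  rewrite (map_comp (nth 0 x) val) val_enum_ord.
  by rewrite -/(mkseq _ _) mkseq_nth.
rewrite -aindep_rk; split=> h p hp; apply: h => //.
  by move=> m; apply/Ksub/fldpP; exact: (mpolyOverP _ hp).
by apply/mpolyOverP => m; apply/fldpP/fld_in.
Qed.

Lemma trdegP (x : seq E) k : trdeg K x k <-> rk K x = k.
Proof.
have [t [st rt et]] := rk_basis K x.
split.
  case=> [[s [hs <- /alg_indepP rs]] h]; apply/eqP; rewrite eqn_leq -et -{2}rs.
  rewrite et rk_subset // andbT -et; apply: h; first exact: mem_subseq.
  exact/alg_indepP.
move=> <-; split; last by move=> s hs /alg_indepP <-; exact: rk_subset.
by exists t; split=> //; [exact: mem_subseq|exact/alg_indepP].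
Qed.

End AlgIndep.

(** * Differential polynomials *)

Section MPolyMap.
Variables (E : fieldType) (k : nat) (g : E -> E).

(** [g] is any map, so that one construction serves the derivation [D] and the isomorphism [sigma],
    which is meaningful only on a subfield. *)
Definition mp_map (p : {mpoly E[k]}) : {mpoly E[k]} := \sum_(m <- msupp p) g p@_m *: 'X_[m].

Lemma mcoeff_mp_map p m : g 0 = 0 -> (mp_map p)@_m = g p@_m.
Proof.
move=> g0; rewrite /mp_map raddf_sum /=; have [hm|hm] := boolP (m \in msupp p).
  rewrite (bigD1_seq m) ?msupp_uniq //= mcoeffZ mcoeffX eqxx mulr1 big1 ?addr0 // => m' ne.
  by rewrite mcoeffZ mcoeffX (negPf ne) mulr0.
rewrite (memN_msupp_eq0 hm) g0 big_seq big1 // => m' hm'.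
rewrite mcoeffZ mcoeffX; case: eqP => [e|]; last by rewrite mulr0.
by rewrite e (negPf hm) in hm'.
Qed.
End MPolyMap.

Section DPoly.
Variables (E : fieldType) (D : E -> E).
Hypothesis derD : is_derivation D.
Hypothesis pchar0 : [pchar E] =i pred0.

Section Basics.
Variable V : Type.
Implicit Types (P Q : dpoly E V) (K : E -> Prop).

(** A strict bound on the orders of the derivatives that occur: 0 means that there are none. *)
Fixpoint dp_ord P : nat :=
  match P with
  | DPc _ => 0
  | DPv _ j => j.+1
  | DPadd P Q | DPmul P Q => maxn (dp_ord P) (dp_ord Q)
  end.

Lemma dp_eval_ext a b P : (forall v j, (j < dp_ord P)%N -> a v j = b v j) ->
  dp_eval a P = dp_eval b P.
Proof.
elim: P => //= [v j|P IHP Q IHQ|P IHP Q IHQ] h; first exact: h.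
  by rewrite IHP ?IHQ // => v j hj; apply: h; rewrite leq_max hj ?orbT.
by rewrite IHP ?IHQ // => v j hj; apply: h; rewrite leq_max hj ?orbT.
Qed.

Lemma dp_eval_deriv (x : V -> E) P :
  dp_eval (djet D x) (dp_deriv D P) = D (dp_eval (djet D x) P).
Proof. by elim: P => //= P -> Q ->; rewrite ?(derA derD) ?(derM derD). Qed.

Lemma dp_eval_iter_deriv (x : V -> E) k P :
  dp_eval (djet D x) (iter k (@dp_deriv E D V) P) = iter k D (dp_eval (djet D x) P).
Proof. by elim: k => //= k; rewrite dp_eval_deriv => ->. Qed.

Lemma dp_coeffs_mono K K' P : (forall c, K c -> K' c) -> dp_coeffs_in K P -> dp_coeffs_in K' P.
Proof. by move=> h; elim: P => //= P IHP Q IHQ []; auto. Qed.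

Lemma dp_coeffs_deriv K P : (forall c, K c -> K (D c)) -> dp_coeffs_in K P ->
  dp_coeffs_in K (dp_deriv D P).
Proof. by move=> h; elim: P => //= P IHP Q IHQ []; auto. Qed.

Lemma dp_coeffs_iter_deriv K k P : (forall c, K c -> K (D c)) -> dp_coeffs_in K P ->
  dp_coeffs_in K (iter k (@dp_deriv E D V) P).
Proof. by move=> h hP; elim: k => //= k; exact: dp_coeffs_deriv. Qed.

Lemma dp_eval_fld (X K : E -> Prop) a P : (forall c, K c -> fld X c) ->
  (forall v j, (j < dp_ord P)%N -> fld X (a v j)) -> dp_coeffs_in K P -> fld X (dp_eval a P).
Proof.
move=> hK; elim: P => //= [c _|v j h _|P IHP Q IHQ h [hP hQ]|P IHP Q IHQ h [hP hQ]].
- exact: hK.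
- exact: h.
- by apply: fldD; [apply: IHP|apply: IHQ] => // v j hj; apply: h; rewrite leq_max hj ?orbT.
- by apply: fldM; [apply: IHP|apply: IHQ] => // v j hj; apply: h; rewrite leq_max hj ?orbT.
Qed.

Lemma dp_eval_pow a P k : dp_eval a (dp_pow P k) = dp_eval a P ^+ k.
Proof. by elim: k => //= k ->; rewrite exprS. Qed.

Lemma dp_coeffs_pow K P k : K 1 -> dp_coeffs_in K P -> dp_coeffs_in K (dp_pow P k).
Proof. by move=> K1 hP; elim: k => //= k IH; split. Qed.

Definition dp_big (op : dpoly E V -> dpoly E V -> dpoly E V) (c : E) (A : Type)
  (F : A -> dpoly E V) (l : seq A) := foldr (fun x acc => op (F x) acc) (DPc c) l.

Lemma dp_eval_bigadd a (A : Type) (F : A -> dpoly E V) l :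
  dp_eval a (dp_big (@DPadd E V) 0 F l) = \sum_(x <- l) dp_eval a (F x).
Proof. by elim: l => [|x l IH] /=; rewrite ?big_nil // big_cons IH. Qed.

Lemma dp_eval_bigmul a (A : Type) (F : A -> dpoly E V) l :
  dp_eval a (dp_big (@DPmul E V) 1 F l) = \prod_(x <- l) dp_eval a (F x).
Proof. by elim: l => [|x l IH] /=; rewrite ?big_nil // big_cons IH. Qed.

Lemma dp_coeffs_bigadd K (A : Type) (F : A -> dpoly E V) l : K 0 ->
  (forall x, dp_coeffs_in K (F x)) -> dp_coeffs_in K (dp_big (@DPadd E V) 0 F l).
Proof. by move=> K0 h; elim: l => //= x l IH; split. Qed.

Lemma dp_coeffs_bigmul K (A : Type) (F : A -> dpoly E V) l : K 1 ->
  (forall x, dp_coeffs_in K (F x)) -> dp_coeffs_in K (dp_big (@DPmul E V) 1 F l).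
Proof. by move=> K1 h; elim: l => //= x l IH; split. Qed.

Fixpoint dp_poly k (g : V -> nat -> {mpoly E[k]}) P : {mpoly E[k]} :=
  match P with
  | DPc c => c%:MP
  | DPv v j => g v j
  | DPadd P Q => dp_poly g P + dp_poly g Q
  | DPmul P Q => dp_poly g P * dp_poly g Q
  end.

Lemma meval_dp_poly k (g : V -> nat -> {mpoly E[k]}) P w :
  (dp_poly g P).@[w] = dp_eval (fun v j => (g v j).@[w]) P.
Proof.
elim: P => //= [c|P <- Q <-|P <- Q <-]; [exact: mevalC|exact: mevalD|exact: mevalM].
Qed.

Lemma dp_poly_over k (g : V -> nat -> {mpoly E[k]}) P K :
  dp_coeffs_in (fld K) P -> (forall v j, g v j \is a mpolyOver k (fldp K)) ->
  dp_poly g P \is a mpolyOver k (fldp K).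
Proof.
move=> hP hg; elim: P hP => //= [c hc|P IHP Q IHQ [hP hQ]|P IHP Q IHQ [hP hQ]].
- by rewrite mpolyOverC; apply/fldpP.
- by rewrite rpredD ?IHP ?IHQ.
- by rewrite rpredM ?IHP ?IHQ.
Qed.

End Basics.

Section Subst.
Variables V W : Type.
Fixpoint dsubst (th : V -> nat -> dpoly E W) (P : dpoly E V) : dpoly E W :=
  match P with
  | DPc c => DPc c
  | DPv v j => th v j
  | DPadd P Q => DPadd (dsubst th P) (dsubst th Q)
  | DPmul P Q => DPmul (dsubst th P) (dsubst th Q)
  end.

Lemma dp_eval_dsubst a th P :
  dp_eval a (dsubst th P) = dp_eval (fun v j => dp_eval a (th v j)) P.
Proof. by elim: P => //= P -> Q ->. Qed.

Lemma dp_coeffs_dsubst K th P : (forall v j, dp_coeffs_in K (th v j)) ->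
  dp_coeffs_in K P -> dp_coeffs_in K (dsubst th P).
Proof. by move=> h; elim: P => //= P IHP Q IHQ []; split; auto. Qed.
End Subst.

Section Jets.
Variable V : finType.
Implicit Types (P Q : dpoly E V) (x : V -> E).

Definition jet x (vj : V * nat) : E := iter vj.2 D (x vj.1).
Definition jidx N : seq (V * nat) := [seq (v, j) | j <- iota 0 N, v <- enum V].

Lemma mem_jidx N v j : ((v, j) \in jidx N) = (j < N)%N.
Proof.
apply/allpairsP/idP => [[[j' v'] /= [hj _ [_ ->]]]|hj]; first by rewrite mem_iota in hj.
by exists (j, v); rewrite mem_iota mem_enum.
Qed.

Lemma uniq_jidx N : uniq (jidx N).
Proof. by rewrite allpairs_uniq ?iota_uniq ?enum_uniq // => -[j v] [j' v'] _ _ [-> ->]. Qed.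

Lemma sub_jidx (idx : seq (V * nat)) : exists N, {subset idx <= jidx N}.
Proof.
elim: idx => [|[v j] idx [N hN]]; first by exists 0%N.
exists (maxn j.+1 N) => -[w k]; rewrite inE mem_jidx leq_max => /orP[/eqP[_ ->]|/hN].
  by rewrite leqnn.
by rewrite mem_jidx => ->; rewrite orbT.
Qed.

Lemma jets_jidx x N :
  flatten [seq map (iter j D) [seq x v | v <- enum V] | j <- iota 0 N] = map (jet x) (jidx N).
Proof.
rewrite /jidx map_flatten -map_comp; congr flatten; apply: eq_map => j /=.
by rewrite -!map_comp.
Qed.

Lemma dindep_findep (K : E -> Prop) x : (forall a, fld K a -> K a) ->
  dindep D K [seq x v | v <- enum V] <-> findep K (jet x).
Proof.
move=> Ks; split.
  move=> h idx u; have [N hN] := sub_jidx idx; apply: (rk_sub_indep u hN).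
  by have := h N; rewrite alg_indepP // jets_jidx size_map.
by move=> h N; rewrite alg_indepP // jets_jidx size_map h // uniq_jidx.
Qed.

Variable idx : seq (V * nat).
Let k := size idx.

Definition xvar (v : V) (j : nat) : {mpoly E[k]} :=
  if insub (index (v, j) idx) is Some i then 'X_i else 0.

Lemma meval_xvar (f : V * nat -> E) v j : (v, j) \in idx ->
  (xvar v j).@[fun i => f (tnth (in_tuple idx) i)] = f (v, j).
Proof.
rewrite /xvar => h; case: insubP => [i _ ei|]; last by rewrite index_mem h.
by rewrite mevalXU (tnth_nth (v, j)) /= ei nth_index.
Qed.

Lemma xvar_over K v j : xvar v j \is a mpolyOver k (fldp K).
Proof. by rewrite /xvar; case: insubP => [i _ _|_]; rewrite ?mpolyOverX ?rpred0. Qed.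

Definition poly_dp (p : {mpoly E[k]}) : dpoly E V :=
  dp_big (@DPadd E V) 0 (fun m : 'X_{1..k} => DPmul (DPc p@_m)
    (dp_big (@DPmul E V) 1 (fun i => let vj := tnth (in_tuple idx) i in dp_pow (DPv _ vj.1 vj.2)
      (m i))
      (enum 'I_k))) (msupp p).

Lemma dp_eval_poly_dp a p :
  dp_eval a (poly_dp p) = p.@[fun i => let vj := tnth (in_tuple idx) i in a vj.1 vj.2].
Proof.
rewrite dp_eval_bigadd mevalE; apply: eq_bigr => m _ /=.
rewrite dp_eval_bigmul big_enum; congr (_ * _); apply: eq_bigr => i _.
by rewrite dp_eval_pow.
Qed.

Lemma dp_coeffs_poly_dp (K : E -> Prop) p : K 0 -> K 1 -> (forall m, K p@_m) ->
  dp_coeffs_in K (poly_dp p).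
Proof.
move=> K0 K1 hp; apply: dp_coeffs_bigadd => // m; split=> //.
by apply: dp_coeffs_bigmul => // i; apply: dp_coeffs_pow.
Qed.

Hypothesis uniq_idx : uniq idx.

Lemma assign_idx (w : 'I_k -> E) : exists a : V -> nat -> E,
  (fun i => let vj := tnth (in_tuple idx) i in a vj.1 vj.2) =1 w.
Proof.
exists (fun v j => if insub (index (v, j) idx) is Some i then w i else 0) => i /=.
rewrite -surjective_pairing (tnth_nth (tnth (in_tuple idx) i)) /= index_uniq //.
by rewrite (insubT (fun i => (i < k)%N) (ltn_ord i)) ; congr (w _); apply: val_inj.
Qed.

Lemma aindep_idx (K : E -> Prop) (f : V * nat -> E) :
  aindep K (fun i : 'I_k => f (tnth (in_tuple idx) i)) <-> rk K (map f idx) = k.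
Proof.
rewrite aindep_rk // map_comp.
by have -> : map (tnth (in_tuple idx)) (enum 'I_k) = idx by rewrite map_tnth_enum.
Qed.

End Jets.

Section Zero.
Variable V : finType.
Implicit Types (P Q : dpoly E V) (x : V -> E).

Definition dp_mpoly N P := dp_poly (xvar (jidx V N)) P.

Lemma meval_dp_mpoly N P a : (dp_ord P <= N)%N ->
  (dp_mpoly N P).@[fun i => let vj := tnth (in_tuple (jidx V N)) i in a vj.1 vj.2] = dp_eval a P.
Proof.
move=> hN; rewrite meval_dp_poly; apply: dp_eval_ext => v j hj.
by rewrite (meval_xvar (fun vj => a vj.1 vj.2)) // mem_jidx (leq_trans hj).
Qed.

Lemma dp_mpoly_eq0 N P : (dp_ord P <= N)%N ->
  dp_mpoly N P = 0 <-> (forall a, dp_eval a P = 0).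
Proof.
move=> hN; split=> [e a|h]; first by rewrite -(meval_dp_mpoly _ hN) e meval0.
apply: mpoly_ext0 => // w; have [a ea] := assign_idx (uniq_jidx V N) w.
by rewrite -(meval_eq _ ea) (meval_dp_mpoly _ hN).
Qed.

(** With [dp0_findep]: a family is independent over [K] exactly when it is a generic zero of the
    zero ideal. *)
Lemma findep_dp0 (K : E -> Prop) x P : findep K (jet x) -> dp_coeffs_in K P ->
  dp_eval (djet D x) P = 0 -> forall a, dp_eval a P = 0.
Proof.
move=> /(_ _ (uniq_jidx V (dp_ord P))) /aindep_idx h hP e.
apply/dp_mpoly_eq0/h; first exact: leqnn.
  apply: dp_poly_over => [|v j]; last exact: xvar_over.
  by apply: dp_coeffs_mono hP => c; exact: fld_in.
by rewrite -[RHS]e -(meval_dp_mpoly (djet D x) (leqnn _)).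
Qed.

Lemma dp0_findep (K : E -> Prop) x : (forall a, fld K a -> K a) ->
  (forall P, dp_coeffs_in K P -> dp_eval (djet D x) P = 0 -> forall a, dp_eval a P = 0) ->
  findep K (jet x).
Proof.
move=> Ks h idx u; apply/aindep_idx => p /mpolyOverP hp e.
have hp' m : K p@_m by apply/Ks/fldpP.
have := h (poly_dp p) (dp_coeffs_poly_dp (Ks _ (fld0 K)) (Ks _ (fld1 K)) hp').
rewrite dp_eval_poly_dp => /(_ e) h0; apply: mpoly_ext0 => // w.
by have [a ea] := assign_idx u w; rewrite -(meval_eq _ ea) -dp_eval_poly_dp.
Qed.

Lemma dp_mul_eq0 P Q : (forall a, dp_eval a (DPmul P Q) = 0) ->
  (forall a, dp_eval a P = 0) \/ (forall a, dp_eval a Q = 0).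
Proof.
pose N := maxn (dp_ord P) (dp_ord Q).
move=> /(dp_mpoly_eq0 (N := N) (P := DPmul P Q) (leqnn _))/eqP.
rewrite mulf_eq0 => /orP[]/eqP h; [left|right]; apply/(dp_mpoly_eq0 (N := N)) => //.
  exact: leq_maxl.
exact: leq_maxr.
Qed.

Section MDeriv.
Variables (k : nat) (s : 'I_k -> {mpoly E[k]}).

Local Notation coefD := (@mp_map E k D).

Lemma coefDD p q : coefD (p + q) = coefD p + coefD q.
Proof.
by apply/mpolyP => m; rewrite mcoeffD !(mcoeff_mp_map _ _ (der0 derD)) mcoeffD (derA derD).
Qed.

Lemma coefDM p q : coefD (p * q) = coefD p * q + p * coefD q.
Proof.
apply/mpolyP => m; rewrite mcoeffD (mcoeff_mp_map _ _ (der0 derD)) !mcoeffM (der_sum derD) //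
  -big_split /=.
by apply: eq_bigr => i _; rewrite (derM derD) // !(mcoeff_mp_map _ _ (der0 derD)).
Qed.

(** The derivation of the polynomial ring that extends [D] and sends ['X_i] to [s i]. *)
Definition mder (p : {mpoly E[k]}) := coefD p + \sum_i p^`M(i) * s i.

Lemma mderD p q : mder (p + q) = mder p + mder q.
Proof.
rewrite /mder coefDD addrACA; congr (_ + _); rewrite -big_split /=.
by apply: eq_bigr => i _; rewrite mderivD mulrDl.
Qed.

Lemma mderM p q : mder (p * q) = mder p * q + p * mder q.
Proof.
rewrite /mder coefDM mulrDl mulrDr addrACA; congr (_ + _).
rewrite mulr_suml mulr_sumr -big_split /=; apply: eq_bigr => i _.
by rewrite mderivM mulrDl mulrA mulrAC.
Qed.

Lemma mder0 : mder 0 = 0.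
Proof. by apply: (addrI (mder 0)); rewrite -mderD !addr0. Qed.

Lemma mderC c : mder c%:MP = (D c)%:MP.
Proof.
rewrite /mder big1 ?addr0 => [|i _]; last by rewrite mderivC mul0r.
apply/mpolyP => m; rewrite (mcoeff_mp_map _ _ (der0 derD)) !mcoeffC; case: eqP;
  rewrite ?mulr1 // !mulr0.
by rewrite (der0 derD).
Qed.

Lemma mderX i : mder 'X_i = s i.
Proof.
rewrite /mder (bigD1 i) //= big1 => [|j ne].
  rewrite mderivX mnm1E eqxx mulr1n.
  have -> : (U_(i) - U_(i))%MM = 0%MM by apply/mnmP => j; rewrite mnmBE subnn mnm0E.
  rewrite scale1r mpolyX0 mul1r addr0.
  suff -> : coefD 'X_i = 0 by rewrite add0r.
  apply/mpolyP => m; rewrite (mcoeff_mp_map _ _ (der0 derD)) mcoeffX mcoeff0.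
  by case: (_ == _); rewrite ?(der1 derD) ?(der0 derD).
by rewrite mderivX mnm1E eq_sym (negPf ne) scale0r mul0r.
Qed.

End MDeriv.

(** [dp_deriv] acts on syntax, and [a] is an arbitrary assignment rather than a family of jets, so
    differentiating the values proves nothing. Instead [dp_deriv] is matched with the derivation
    [mder] of a polynomial ring, which sends 0 to 0. *)
Lemma dp_deriv_eq0 P : (forall a, dp_eval a P = 0) -> forall a, dp_eval a (dp_deriv D P) = 0.
Proof.
move=> h a; pose N := (dp_ord P).+1; pose idx := jidx V N.
have ltN := leqnSn (dp_ord P).
(* On the jets of top order [s] takes the dummy value 0 of [xvar]; these are never differentiated,
   as the jets in [P] have order below [N.-1]. *)
pose s (i : 'I_(size idx)) := let vj := tnth (in_tuple idx) i in xvar idx vj.1 vj.2.+1.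
have sx v j : (j.+1 < N)%N -> mder s (xvar idx v j) = xvar idx v j.+1.
  rewrite {1}/xvar => hj; case: insubP => [i _ ei|]; last first.
    by rewrite index_mem mem_jidx (ltn_trans _ hj).
  by rewrite mderX /s (tnth_nth (v, j)) /= ei nth_index // mem_jidx (ltn_trans _ hj).
have comm Q : (dp_ord Q < N)%N -> dp_poly (xvar idx) (dp_deriv D Q) = mder s (dp_poly (xvar idx) Q).
  elim: Q => //= [c _|v j hj|Q IHQ R IHR|Q IHQ R IHR].
  - by rewrite mderC.
  - by rewrite sx.
  - by rewrite gtn_max => /andP[hQ hR]; rewrite IHQ ?IHR // mderD.
  - by rewrite gtn_max => /andP[hQ hR]; rewrite IHQ ?IHR // mderM.
have ordD Q : (dp_ord (dp_deriv D Q) <= (dp_ord Q).+1)%N.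
  by elim: Q => //= Q hQ R hR; rewrite -maxnSS !geq_max !leq_max hQ hR ?leqnSn ?orbT.
rewrite -(meval_dp_mpoly a (ordD P)) /dp_mpoly -/N -/idx comm ?ltnSn //.
have -> : dp_poly (xvar idx) P = 0 by apply/(dp_mpoly_eq0 (N := N)).
by rewrite mder0 meval0.
Qed.

End Zero.

End DPoly.

(** * Coefficients with respect to a block of variables *)

Section Coefficients.
Variables (E : fieldType) (V : finType) (isx : pred V) (N : nat).
Definition xidx := [seq vj <- jidx V N | isx vj.1].
Let idx := xidx.
Let k := size idx.
Implicit Types (P Q : dpoly E V) (b : V -> nat -> E).

Definition part_var b (v : V) (j : nat) : {mpoly E[k]} :=
  if isx v then xvar E idx v j else (b v j)%:MP.

Lemma uniq_xidx : uniq idx. Proof. exact/filter_uniq/uniq_jidx. Qed.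

(* [cf P m] is the coefficient of the monomial [m] in [P] read as a polynomial
   in the derivatives of the variables selected by [isx]. *)
Fixpoint cf P (m : 'X_{1..k}) : dpoly E V :=
  match P with
  | DPc c => DPc (if m == 0%MM then c else 0)
  | DPv v j => if isx v then DPc (xvar E idx v j)@_m
               else if m == 0%MM then DPv _ v j else DPc 0
  | DPadd P Q => DPadd (cf P m) (cf Q m)
  | DPmul P Q => dp_big (@DPadd E V) 0
      (fun kk : 'X_{1..k < (mdeg m).+1, (mdeg m).+1} => DPmul (cf P kk.1) (cf Q kk.2))
      [seq kk : 'X_{1..k < (mdeg m).+1, (mdeg m).+1} <-
        enum {: 'X_{1..k < (mdeg m).+1, (mdeg m).+1}}
        | m == (kk.1 + kk.2)%MM]
  end.

Lemma dp_eval_cf b P m : dp_eval b (cf P m) = (dp_poly (part_var b) P)@_m.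
Proof.
elim: P m => /= [c|v j|P IHP Q IHQ|P IHP Q IHQ] m.
- by rewrite mcoeffC eq_sym; case: eqP; rewrite ?mulr1 ?mulr0.
- rewrite /part_var; case: ifP => // _; rewrite mcoeffC eq_sym.
  by case: eqP; rewrite ?mulr1 ?mulr0.
- by rewrite mcoeffD IHP IHQ.
- rewrite dp_eval_bigadd mcoeffM big_filter big_enum_cond /=.
  by apply: eq_bigr => i _; rewrite IHP IHQ.
Qed.

Lemma dp_coeffs_cf (K : E -> Prop) P m : (forall a, fld K a -> K a) ->
  dp_coeffs_in K P -> dp_coeffs_in K (cf P m).
Proof.
move=> Ks; have K0 := Ks _ (fld0 K).
elim: P m => /= [c|v j|P IHP Q IHQ|P IHP Q IHQ] m.
- by case: eqP.
- case: ifP => [_ _|_]; last by case: eqP.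
  by have /mpolyOverP/(_ m)/fldpP/Ks := xvar_over idx K v j.
- by case; split; auto.
- by case=> hP hQ; apply: dp_coeffs_bigadd => // kk; split; auto.
Qed.

(** The bound must be uniform in [b]: the expansion of [P] has to be one finite sum that holds
    identically in the remaining variables. *)
Lemma msize_part P : exists B, forall b, (msize (dp_poly (part_var b) P) <= B)%N.
Proof.
elim: P => /= [c|v j|P [B hB] Q [C hC]|P [B hB] Q [C hC]].
- by exists (msize c%:MP_[k]).
- exists (maxn 1 (msize (xvar E idx v j))) => b; rewrite /part_var; case: ifP => _.
    exact: leq_maxr.
  by rewrite msizeC leq_max; case: eqP.
- exists (maxn B C) => b; apply: leq_trans (msizeD_le _ _) _.
  by rewrite geq_max !leq_max hB hC orbT.
- exists (B + C).+1 => b; apply: leq_trans (msizeM_le _ _) _.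
  by rewrite ltnS leq_add.
Qed.

Lemma meval_part a b P : (dp_ord P <= N)%N ->
  (dp_poly (part_var b) P).@[fun i => let vj := tnth (in_tuple idx) i in a vj.1 vj.2] =
  dp_eval (fun v j => if isx v then a v j else b v j) P.
Proof.
move=> hN; rewrite meval_dp_poly; apply: dp_eval_ext => v j hj.
rewrite /part_var; case: ifP => hv; last by rewrite mevalC.
by rewrite (meval_xvar (fun vj => a vj.1 vj.2)) // mem_filter hv mem_jidx (leq_trans hj).
Qed.

Lemma part_expand a P : (dp_ord P <= N)%N ->
  exists (B : nat) (mon : 'X_{1..k} -> E),
    (forall (X : E -> Prop) m, (forall v j, isx v -> fld X (a v j)) -> fld X (mon m)) /\
    forall b, dp_eval (fun v j => if isx v then a v j else b v j) P =
      \sum_(m : 'X_{1..k < B}) dp_eval b (cf P m) * mon m.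
Proof.
move=> hN; have [B hB] := msize_part P; exists B.
exists (fun m => ('X_[m] : {mpoly E[k]}).@[fun i => let vj := tnth (in_tuple idx) i in
  a vj.1 vj.2]).
split=> [X m ha|b].
  apply: mpolyOver_evalP => [m'|i]; first by rewrite mcoeffX; case: (_ == _);
    [exact: fld1|exact: fld0].
  by apply: ha; have := mem_tnth i (in_tuple idx); rewrite mem_filter => /andP[].
rewrite -meval_part // {1}(mpolywE (hB b)) raddf_sum /=.
by apply: eq_bigr => m _; rewrite mevalZ dp_eval_cf.
Qed.

End Coefficients.
Arguments cf {E V} isx N P m.
Arguments part_var {E V} isx N b v j.

Section Comb.
Variables (E : fieldType) (V W : finType).
Definition comb (a : V -> nat -> E) (b : W -> nat -> E) (s : V + W) (j : nat) : E :=
  match s with inl v => a v j | inr w => b w j end.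

Definition inlp : pred (V + W) := fun s => if s is inl _ then true else false.
Definition inrp : pred (V + W) := fun s => if s is inr _ then true else false.

Definition projl : dpoly E (V + W) -> dpoly E V :=
  dsubst (fun s j => match s with inl v => DPv E v j | inr w => DPc 0 end).
Definition projr : dpoly E (V + W) -> dpoly E W :=
  dsubst (fun s j => match s with inl v => DPc 0 | inr w => DPv E w j end).

Lemma dp_eval_projl a P : dp_eval a (projl P) = dp_eval (comb a (fun _ _ => 0)) P.
Proof. by rewrite dp_eval_dsubst; apply: dp_eval_ext => -[v|w] j _. Qed.
Lemma dp_eval_projr b P : dp_eval b (projr P) = dp_eval (comb (fun _ _ => 0) b) P.
Proof. by rewrite dp_eval_dsubst; apply: dp_eval_ext => -[v|w] j _. Qed.
Lemma dp_coeffs_projl (K : E -> Prop) P : K 0 -> dp_coeffs_in K P -> dp_coeffs_in K (projl P).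
Proof. by move=> K0; apply: dp_coeffs_dsubst => -[v|w] j. Qed.
Lemma dp_coeffs_projr (K : E -> Prop) P : K 0 -> dp_coeffs_in K P -> dp_coeffs_in K (projr P).
Proof. by move=> K0; apply: dp_coeffs_dsubst => -[v|w] j. Qed.

Hypothesis pchar0 : [pchar E] =i pred0.
Variable D : E -> E.

(** A relation between a family independent over [G] and elements of [G] is a polynomial over [G]
    vanishing at that family, so it holds coefficient by coefficient. The assignment [a] is
    arbitrary because the coefficients do not involve the left block. *)
Lemma findep_cf (F G : E -> Prop) x b (P : dpoly E (V + W)) N m :
  (dp_ord P <= N)%N ->
  findep G (jet D x) -> dp_coeffs_in F P -> (forall c, F c -> fld G c) ->
  (forall w j, fld G (b w j)) -> dp_eval (comb (djet D x) b) P = 0 ->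
  forall a, dp_eval (comb a b) (cf inlp N P m) = 0.
Proof.
move=> hN ix hP hF hb e a; rewrite dp_eval_cf.
suff -> : dp_poly (part_var inlp N (comb a b)) P = 0 by rewrite mcoeff0.
have /(aindep_idx pchar0) h : rk G [seq comb (djet D x) b vj.1 vj.2 | vj <- xidx inlp N] =
  size (xidx inlp N).
  pose f (vj : (V + W) * nat) := if vj.1 is inl v then Some (v, vj.2) else None.
  have e1 l : all (fun vj : (V + W) * nat => inlp vj.1) l ->
      [seq comb (djet D x) b vj.1 vj.2 | vj <- l] = [seq jet D x vj | vj <- pmap f l].
    by elim: l => //= -[[v|w] j] l IH //= /IH ->.
  rewrite e1 ?filter_all // ix.
    by rewrite -(size_map (jet D x)) -e1 ?filter_all // size_map.
  apply: (pmap_uniq (g := fun vj => (inl vj.1, vj.2))); last exact: uniq_xidx.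
  by case=> [[v|w] j].
apply: h.
  apply: dp_poly_over => [|[v|w] j]; first exact: dp_coeffs_mono hP.
    exact: xvar_over.
  by rewrite /part_var /= mpolyOverC; apply/fldpP.
rewrite -[RHS]e (meval_part inlp (comb (djet D x) b)) //.
by apply: dp_eval_ext => -[v|w] j.
Qed.

(** The coefficients of [P] with respect to the right block are polynomials over [F] vanishing at
    the independent [x], hence identically zero; so they vanish at any [x']. *)
Lemma findep_transfer (F : E -> Prop) x x' (P : dpoly E (V + W)) :
  (forall c, fld F c -> F c) -> findep F (jet D x) -> dp_coeffs_in F P ->
  (forall b, dp_eval (comb (djet D x) b) P = 0) ->
  forall b, dp_eval (comb (djet D x') b) P = 0.
Proof.
move=> Fs ix hP h b; pose N := dp_ord P.
have cf0 m a : dp_eval (comb a (fun _ _ => 0)) (cf inrp N P m) = 0.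
  rewrite -dp_eval_projl; move: a; apply: (findep_dp0 pchar0 ix).
    by apply: dp_coeffs_projl; [exact/Fs/fld0|exact: dp_coeffs_cf].
  rewrite dp_eval_projl dp_eval_cf.
  suff -> : dp_poly (part_var inrp N (comb (djet D x) (fun _ _ => 0))) P = 0 by rewrite mcoeff0.
  apply: mpoly_ext0 => // w; have [a ea] := assign_idx (uniq_xidx inrp N) w.
  rewrite -(meval_eq _ ea) (meval_part inrp a) // -[RHS](h (fun w j => a (inr w) j)).
  by apply: dp_eval_ext => -[v|w'] j.
have e0 : dp_poly (part_var inrp N (comb (djet D x') (fun _ _ => 0))) P = 0.
  by apply/mpolyP => m; rewrite -dp_eval_cf cf0 mcoeff0.
have := meval_part inrp (comb (djet D x') b) (comb (djet D x') (fun _ _ => 0)) (leqnn (dp_ord P)).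
rewrite -/N e0 meval0 => ->.
by apply: dp_eval_ext => -[v|w] j.
Qed.

End Comb.

(** * Specializing differentially independent families *)

Section DField.
Variables (E : fieldType) (D : E -> E) (F : E -> Prop).
Hypothesis derD : is_derivation D.
Hypothesis pchar0 : [pchar E] =i pred0.
Hypothesis dsF : is_dsubfield D F.

Lemma dsubfield_fld a : fld F a -> F a.
Proof. by case: dsF => [_ [? [? [? [? _]]]]]; apply: fld_min. Qed.
Lemma dsubfield_der a : F a -> F (D a).
Proof. by case: dsF => [_ [_ [_ [_ [_ h]]]]]; exact: h. Qed.
Lemma dsubfield0 : F 0. Proof. exact/dsubfield_fld/fld0. Qed.
Lemma dsubfield1 : F 1. Proof. exact/dsubfield_fld/fld1. Qed.
Let F0 := dsubfield0.
Let F1 := dsubfield1.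

Section Gen.
Variables (V : finType) (x : V -> E).
Let K := dfgen D F x.

Lemma dfgen_eval P : dp_coeffs_in F P -> K (dp_eval (djet D x) P).
Proof. by move=> hP; exists P, (DPc 1); split=> //=; rewrite ?oner_eq0 ?divr1. Qed.

Lemma dfgen_base c : F c -> K c.
Proof. by move=> hc; exact: (@dfgen_eval (DPc c)). Qed.

Lemma dfgen_jet v j : K (djet D x v j).
Proof. exact: (@dfgen_eval (DPv E v j)). Qed.

Lemma dfgen_fld a : fld K a -> K a.
Proof.
have FN1 : F (-1) by apply: dsubfield_fld; exact/fldN/fld1.
apply: fld_min => //; first exact: dfgen_base.
- move=> _ _ [P [Q [hP hQ nQ ->]]] [P' [Q' [hP' hQ' nQ' ->]]].
  exists (DPadd (DPmul P Q') (DPmul (DPc (-1)) (DPmul P' Q))), (DPmul Q Q'); split=> //=.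
    by rewrite mulf_neq0.
  by rewrite -mulNr addf_div // mulN1r mulNr.
- move=> _ _ [P [Q [hP hQ nQ ->]]] [P' [Q' [hP' hQ' nQ' ->]]].
  exists (DPmul P P'), (DPmul Q Q'); split=> //=; first by rewrite mulf_neq0.
  by rewrite mulf_div.
- move=> _ [P [Q [hP hQ nQ ->]]]; have [p0|p0] := eqVneq (dp_eval (djet D x) P) 0.
    by rewrite p0 mul0r invr0; apply: dfgen_base.
  by exists Q, P; rewrite invf_div.
Qed.

Definition quot_der (P Q : dpoly E V) : dpoly E V :=
  DPadd (DPmul (dp_deriv D P) Q) (DPmul (DPc (-1)) (DPmul P (dp_deriv D Q))).

Lemma dp_coeffs_quot_der P Q : dp_coeffs_in F P -> dp_coeffs_in F Q ->
  dp_coeffs_in F (quot_der P Q).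
Proof.
have FN1 : F (-1) by apply: dsubfield_fld; exact/fldN/fld1.
by move=> hP hQ; do !split=> //; apply: dp_coeffs_deriv => // c; exact: dsubfield_der.
Qed.

Lemma dp_eval_quot_der P Q (ev := dp_eval (djet D x)) : ev Q != 0 ->
  D (ev P / ev Q) = ev (quot_der P Q) / ev (DPmul Q Q).
Proof.
move=> nQ; rewrite (derM derD) (derV derD) /ev /= !dp_eval_deriv // -/(ev P) -/(ev Q).
rewrite mulrDl mulN1r mulNr mulrN; congr (_ - _).
  by rewrite -mulf_div divff // mulr1.
by rewrite mulrA mulrA invfM !mulrA.
Qed.

Lemma dfgen_der a : K a -> K (D a).
Proof.
move=> [P [Q [hP hQ nQ ->]]]; exists (quot_der P Q), (DPmul Q Q).
rewrite dp_eval_quot_der // mulf_neq0 //; split=> //; exact: dp_coeffs_quot_der.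
Qed.

Lemma dfgen_dsubfield : is_dsubfield D K.
Proof.
split; first exact: dfgen_base.
split; first exact: dfgen_base.
split; first by move=> a b ha hb; apply/dfgen_fld/fldB; apply: fld_in.
split; first by move=> a b ha hb; apply/dfgen_fld/fldM; apply: fld_in.
split; first by move=> a ha; apply/dfgen_fld/fldV; apply: fld_in.
exact: dfgen_der.
Qed.

Lemma dfgen_sub a : K a -> fld (extx F (jet D x) (fun=> True)) a.
Proof.
have h P : dp_coeffs_in F P -> fld (extx F (jet D x) (fun=> True)) (dp_eval (djet D x) P).
  apply: dp_eval_fld => [c hc|v j _]; apply: fld_in; first by left.
  by right; exists (v, j).
by case=> P [Q [hP hQ _ ->]]; apply: fldM; [|apply: fldV]; exact: h.
Qed.

(* [w] is a generic zero of the zero ideal. *)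
Lemma exists_generic (W : finType) : universal D F ->
  exists w : W -> E, findep K (jet D w).
Proof.
move=> univ; pose J (P : dpoly E 'I_#|W|) := dp_coeffs_in K P /\ forall a, dp_eval a P = 0.
have [|w hw] := univ V x #|W| J.
  split; first (split; [|split; [|split; [|split; [|split]]]]).
  - by move=> P [].
  - by split=> [|a /=] //; exact: dfgen_base.
  - by move=> P Q hQ e [_ h]; split=> // a; rewrite -e.
  - by move=> P Q [hP zP] [hQ zQ]; split=> // a /=; rewrite zP zQ addr0.
  - by move=> P Q hP [hQ zQ]; split=> // a /=; rewrite zQ mulr0.
  - move=> P [hP zP]; split; last exact: dp_deriv_eq0.
    by apply: dp_coeffs_deriv => // c; exact: dfgen_der.
  - by case=> _ /(_ (fun _ _ => 0))/eqP; rewrite oner_eq0.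
  - by move=> P Q hP hQ [_ /(dp_mul_eq0 pchar0)[]]; [left|right].
exists (w \o enum_rank); apply: dp0_findep => //; first exact: dfgen_fld.
move=> P hP e a.
pose Q := dsubst (fun v j => DPv E (enum_rank v) j) P.
have hQ : dp_coeffs_in K Q by apply: dp_coeffs_dsubst.
have [|_ hz] := (hw Q hQ).2; first by rewrite dp_eval_dsubst -[RHS]e.
have := hz (fun i j => a (enum_val i) j); rewrite dp_eval_dsubst => <-.
by apply: dp_eval_ext => v j _ /=; rewrite enum_rankK.
Qed.

End Gen.

Section Sigma.
Variables (V : finType) (x x' : V -> E).
Hypotheses (ix : findep F (jet D x)) (ix' : findep F (jet D x')).
Let K := dfgen D F x.
Let ev := dp_eval (djet D x).
Let ev' := dp_eval (djet D x').

Lemma transfer0 P : dp_coeffs_in F P -> ev P = 0 <-> ev' P = 0.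
Proof. by move=> hP; split=> e; [apply: (findep_dp0 pchar0 ix)|apply: (findep_dp0 pchar0 ix')]. Qed.

(* The isomorphism F<x> -> F<x'>; its values outside F<x> are arbitrary. *)
Definition sigma (z : E) : E := epsilon (inhabits 0) (fun w => exists P Q,
  [/\ dp_coeffs_in F P, dp_coeffs_in F Q, ev Q != 0, z = ev P / ev Q & w = ev' P / ev' Q]).

Lemma transfer_neq0 Q : dp_coeffs_in F Q -> ev Q != 0 -> ev' Q != 0.
Proof. by move=> hQ; apply: contraNneq => /(transfer0 hQ)->. Qed.

(** Independence of the chosen fraction: cross multiplying two representations gives a relation over
    [F] at [x], which [transfer0] carries to [x']. *)
Lemma sigma_frac P Q : dp_coeffs_in F P -> dp_coeffs_in F Q -> ev Q != 0 ->
  sigma (ev P / ev Q) = ev' P / ev' Q.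
Proof.
move=> hP hQ nQ; rewrite /sigma.
set S := fun w : E => _; have : exists w, S w by exists (ev' P / ev' Q), P, Q.
case/(epsilon_spec (inhabits 0)) => P1 [Q1 [hP1 hQ1 nQ1 e ->]].
apply/eqP; rewrite eqr_div ?transfer_neq0 //.
move/eqP: e; rewrite eqr_div // => /eqP e.
have FN1 : F (-1) by apply: dsubfield_fld; exact/fldN/fld1.
have := @transfer0 (DPadd (DPmul P Q1) (DPmul (DPc (-1)) (DPmul P1 Q))) _.
rewrite /ev /ev' /= !mulN1r -/ev -/ev' e subrr => h.
by rewrite eq_sym -subr_eq0; apply/eqP/h.
Qed.

Lemma sigma_eval P : dp_coeffs_in F P -> sigma (ev P) = ev' P.
Proof.
by move=> hP; have := @sigma_frac P (DPc 1) hP F1; rewrite /ev /ev' /= !divr1; apply;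
  exact: oner_neq0.
Qed.

Lemma sigma_base c : F c -> sigma c = c.
Proof. by move=> hc; exact: (@sigma_eval (DPc c)). Qed.

Lemma sigma_jet v j : sigma (djet D x v j) = djet D x' v j.
Proof. exact: (@sigma_eval (DPv E v j)). Qed.

Lemma sigma_der a : K a -> sigma (D a) = D (sigma a).
Proof.
move=> [P [Q [hP hQ nQ ->]]]; rewrite -/ev in nQ *; have nQ' := transfer_neq0 hQ nQ.
rewrite sigma_frac // /ev /ev' !dp_eval_quot_der //.
apply: (@sigma_frac (quot_der P Q) (DPmul Q Q)) => //; first exact: dp_coeffs_quot_der.
by rewrite /ev /= mulf_neq0.
Qed.

Lemma sigma_in a : K a -> dfgen D F x' (sigma a).
Proof.
move=> [P [Q [hP hQ nQ ->]]]; rewrite -/ev in nQ *; rewrite sigma_frac //.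
by exists P, Q; split=> //; exact: transfer_neq0.
Qed.

End Sigma.

Lemma sigmaK (V : finType) (x x' : V -> E) z : findep F (jet D x) -> findep F (jet D x') ->
  dfgen D F x z -> sigma x' x (sigma x x' z) = z.
Proof.
move=> ix ix' [P [Q [hP hQ nQ ->]]].
by rewrite sigma_frac // sigma_frac //; exact: (transfer_neq0 ix ix').
Qed.

End DField.

Fixpoint dp_map (E : fieldType) (V : Type) (g : E -> E) (P : dpoly E V) : dpoly E V :=
  match P with
  | DPc c => DPc (g c)
  | DPv v j => DPv E v j
  | DPadd P Q => DPadd (dp_map g P) (dp_map g Q)
  | DPmul P Q => DPmul (dp_map g P) (dp_map g Q)
  end.

Section Specialize.
Variables (E : fieldType) (D : E -> E) (F : E -> Prop).
Hypothesis derD : is_derivation D.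
Hypothesis pchar0 : [pchar E] =i pred0.
Hypothesis dsF : is_dsubfield D F.
Variables (V W : finType) (x x' : V -> E).
Hypotheses (ix : findep F (jet D x)) (ix' : findep F (jet D x')).
Let K := dfgen D F x.
Let ev := dp_eval (djet D x).
Let ev' := dp_eval (djet D x').
Let sg := sigma D F x x'.
Implicit Types (P Q : dpoly E W).

Lemma dp_map_id (U : Type) (P : dpoly E U) : dp_coeffs_in F P -> dp_map sg P = P.
Proof.
elim: P => //= [c hc|P IHP Q IHQ [/IHP-> /IHQ->]|P IHP Q IHQ [/IHP-> /IHQ->]] //.
by rewrite /sg sigma_base.
Qed.

(** The same [q] and [Pt] over [F] serve [P] at [x] and its image under [sigma] at [x']; statements
    about the isomorphism thus reduce to polynomials over [F]. *)
Lemma clear_denoms P : dp_coeffs_in K P -> exists (q : dpoly E V) (Pt : dpoly E (V + W)),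
  [/\ dp_coeffs_in F q, dp_coeffs_in F Pt, ev q != 0 &
    forall b, ev q * dp_eval b P = dp_eval (comb (djet D x) b) Pt /\
              ev' q * dp_eval b (dp_map sg P) = dp_eval (comb (djet D x') b) Pt].
Proof.
have F1 := dsubfield1 dsF.
pose inj := dsubst (fun v j => DPv E (inl v : V + W) j).
have injE y b q : dp_eval (comb y b) (inj q) = dp_eval y q.
  by rewrite dp_eval_dsubst; apply: dp_eval_ext.
have injF q : dp_coeffs_in F q -> dp_coeffs_in F (inj q) by apply: dp_coeffs_dsubst.
elim: P => /= [c [A [B [hA hB nB e]]]|w j _|P IHP Q IHQ [kP kQ]|P IHP Q IHQ [kP kQ]].
- exists B, (inj A); split=> //; first exact: injF.
  have nB' : ev' B != 0 by exact: (transfer_neq0 pchar0 ix ix').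
  move=> b; rewrite !injE e /sg sigma_frac //; split.
    by rewrite mulrC divfK.
  by rewrite mulrC divfK.
- exists (DPc 1), (DPv E (inr w) j); rewrite /ev /ev' /= oner_eq0; split=> // b.
  by rewrite !mul1r.
- have [q [Pt [hq hPt nq h]]] := IHP kP; have [q2 [Qt [hq2 hQt nq2 h2]]] := IHQ kQ.
  exists (DPmul q q2), (DPadd (DPmul (inj q2) Pt) (DPmul (inj q) Qt)).
  rewrite /ev /ev' /= mulf_neq0 //; split=> //; first by do !split=> //; exact: injF.
  move=> b; rewrite !injE -/ev -/ev'; have [<- <-] := h b; have [<- <-] := h2 b.
  by split; rewrite mulrDr; congr (_ + _); rewrite !mulrA // [_ q2 * _]mulrC.
- have [q [Pt [hq hPt nq h]]] := IHP kP; have [q2 [Qt [hq2 hQt nq2 h2]]] := IHQ kQ.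
  exists (DPmul q q2), (DPmul Pt Qt).
  rewrite /ev /ev' /= mulf_neq0 //; split=> //.
  move=> b; rewrite -/ev -/ev'; have [<- <-] := h b; have [<- <-] := h2 b.
  by split; rewrite mulrACA.
Qed.

(** [dp_map] acts on syntax; that it respects extensional equality has to be proved, since
    membership in [sp_ideal] must be invariant under [dp_eq]. *)
Lemma dp_map_eq0 P : dp_coeffs_in K P -> (forall b, dp_eval b P = 0) ->
  forall b, dp_eval b (dp_map sg P) = 0.
Proof.
move=> kP h b; have [q [Pt [hq hPt nq e]]] := clear_denoms kP.
apply: (mulfI (transfer_neq0 pchar0 ix ix' hq nq)); rewrite mulr0 (e b).2.
apply: (findep_transfer pchar0 x' _ ix hPt); first exact: (dsubfield_fld dsF).
by move=> b'; rewrite -(e b').1 h mulr0.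
Qed.

Lemma dp_map_eq P Q : dp_coeffs_in K P -> dp_coeffs_in K Q -> dp_eq P Q ->
  forall b, dp_eval b (dp_map sg P) = dp_eval b (dp_map sg Q).
Proof.
move=> kP kQ e b; pose R := DPadd P (DPmul (DPc (-1)) Q).
have FN1 : F (-1) by apply: (dsubfield_fld dsF); exact/fldN/fld1.
have kR : dp_coeffs_in K R by do !split=> //; exact: dfgen_base.
have := dp_map_eq0 kR _ b; rewrite /= /sg sigma_base // mulN1r => h.
by apply/eqP; rewrite -subr_eq0; apply/eqP/h => b'; rewrite /= e mulN1r subrr.
Qed.

Lemma dp_map_deriv (y : W -> E) P : dp_coeffs_in K P ->
  dp_eval (djet D y) (dp_map sg (dp_deriv D P)) = D (dp_eval (djet D y) (dp_map sg P)).
Proof.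
elim: P => //= [c hc|P IHP Q IHQ [kP kQ]|P IHP Q IHQ [kP kQ]].
- exact: (sigma_der derD pchar0 dsF ix ix').
- by rewrite IHP ?IHQ // (derA derD).
- by rewrite IHP ?IHQ // (derM derD).
Qed.

Variable eta : W -> E.

(* The ideal of [eta] over F<x'>, pulled back along the isomorphism F<x> -> F<x'>. *)
Definition sp_ideal P : Prop := dp_coeffs_in K P /\ dp_eval (djet D eta) (dp_map sg P) = 0.

Lemma sp_ideal_prime : is_prime_dideal D K sp_ideal.
Proof.
have kc c : F c -> K c by exact: dfgen_base.
have F0 := dsubfield0 dsF; have F1 := dsubfield1 dsF.
split; first (split; [|split; [|split; [|split; [|split]]]]).
- by move=> P [].
- by split=> /=; [exact: kc|rewrite /sg sigma_base].
- by move=> P Q kQ e [kP h]; split=> //; rewrite -(dp_map_eq kP kQ e).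
- by move=> P Q [kP hP] [kQ hQ]; split=> //=; rewrite hP hQ addr0.
- by move=> P Q kP [kQ hQ]; split=> //=; rewrite hQ mulr0.
- move=> P [kP hP]; split; last by rewrite dp_map_deriv // hP (der0 derD).
  by apply: dp_coeffs_deriv kP => c; exact: dfgen_der.
- by case=> _ /eqP; rewrite /= /sg sigma_base // oner_eq0.
- move=> P Q kP kQ [_ /eqP]; rewrite /= mulf_eq0 => /orP[]/eqP h; [left|right]; split=> //.
Qed.

End Specialize.

(** * From relations at the generic zero to membership in the generated ideal *)

Section Elimination.
Variables (E : fieldType) (D : E -> E) (F : E -> Prop).
Hypothesis derD : is_derivation D.
Hypothesis pchar0 : [pchar E] =i pred0.
Hypothesis dsF : is_dsubfield D F.
Variables (V W : finType) (u w0 : V -> E) (v0 : V) (eta : W -> E).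
Variables (fhat : dpoly E (V + W)) (I I1 : dpoly E W -> Prop).
Hypothesis fhatF : dp_coeffs_in F fhat.
Hypothesis genI : is_generic_zero D F I eta.
Let G := dfgen D F eta.
Let K := dfgen D F u.
Hypothesis iw0 : findep G (jet D w0).

Definition evu : dpoly E (V + W) -> dpoly E W :=
  dsubst (fun s j => match s with inl v => DPc (djet D u v j) | inr w => DPv E w j end).

Lemma dp_eval_evu b P : dp_eval b (evu P) = dp_eval (comb (djet D u) b) P.
Proof. by rewrite dp_eval_dsubst; apply: dp_eval_ext => -[v|w] j _. Qed.

Lemma dp_coeffs_evu P : dp_coeffs_in F P -> dp_coeffs_in K (evu P).
Proof.
move=> hP; apply: dp_coeffs_dsubst; last by apply: dp_coeffs_mono hP => c; exact: dfgen_base.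
by move=> [v|w] j //=; exact: dfgen_jet.
Qed.

Hypothesis I1_0 : I1 (DPc 0).
Hypothesis I1_eq : forall P Q, dp_coeffs_in K Q -> dp_eq P Q -> I1 P -> I1 Q.
Hypothesis I1_add : forall P Q, I1 P -> I1 Q -> I1 (DPadd P Q).
Hypothesis I1_mul : forall P Q, dp_coeffs_in K P -> I1 Q -> I1 (DPmul P Q).
Hypothesis I1_I : forall P, I P -> I1 P.
Hypothesis I1_f : forall k, I1 (evu (iter k (@dp_deriv E D _) fhat)).

(* Makes [fhat] vanish at [eta] when [fhat] is the generic polynomial and [v0] the monomial 1. *)
Definition shifted (v : V) : E :=
  if v == v0 then w0 v0 - dp_eval (comb (djet D w0) (djet D eta)) fhat else w0 v.

(** The passage from [w0] to [shifted], performed on indeterminates. At [(w0, eta)] the value of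
    [sub P] is that of [P] at [(shifted, eta)]; at [u] the two differ only by multiples of
    derivatives of [fhat]. *)
Let sub : dpoly E (V + W) -> dpoly E (V + W) :=
  dsubst (fun s j => match s with
    | inl v => if v == v0 then
        DPadd (DPv E (inl v0) j) (DPmul (DPc (-1)) (iter j (@dp_deriv E D _) fhat))
        else DPv E s j
    | inr w => DPv E s j end).

Let FN1 : F (-1). Proof. by apply: (dsubfield_fld dsF); exact/fldN/fld1. Qed.
Let KN1 : K (-1). Proof. exact: dfgen_base. Qed.

Let fhat_deriv j : dp_coeffs_in F (iter j (@dp_deriv E D _) fhat).
Proof. by apply: dp_coeffs_iter_deriv => // c; exact: (dsubfield_der dsF). Qed.

Let subF P : dp_coeffs_in F P -> dp_coeffs_in F (sub P).
Proof. by apply: dp_coeffs_dsubst => -[v|w] j //=; case: ifP => //= _; do !split. Qed.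

Let dsubE A B : dp_coeffs_in F A -> dp_coeffs_in F B ->
  dp_coeffs_in K (DPadd (evu A) (DPmul (DPc (-1)) (evu B))).
Proof. by move=> hA hB; do !split=> //; apply: dp_coeffs_evu. Qed.

Lemma sub_congr P : dp_coeffs_in F P -> I1 (DPadd (evu P) (DPmul (DPc (-1)) (evu (sub P)))).
Proof.
elim: P => /= [c hc|[v|w] j _|P IHP Q IHQ [hP hQ]|P IHP Q IHQ [hP hQ]].
- apply: I1_eq I1_0; last by move=> b /=; rewrite mulN1r subrr.
  by do !split=> //; exact: dfgen_base.
- have [->|ne] := eqVneq v v0.
    apply: I1_eq (I1_f j).
      apply: (@dsubE (DPv E (inl v0) j) (sub (DPv E (inl v0) j))) => //.
      exact: (subF (P := DPv E (inl v0) j)).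
    by move=> b; rewrite /sub /= !dp_eval_evu /= eqxx /= !mulN1r opprB addrC subrK.
  rewrite /sub /= (negPf ne) /=.
  apply: I1_eq I1_0; first by do !split=> //; exact: dfgen_jet.
  by move=> b /=; rewrite mulN1r subrr.
- apply: I1_eq I1_0; first by do !split.
  by move=> b /=; rewrite mulN1r subrr.
- apply: I1_eq (I1_add (IHP hP) (IHQ hQ)).
    by apply: (@dsubE (DPadd P Q) (sub (DPadd P Q))) => //; apply: (subF (P := DPadd P Q)).
  by move=> b /=; rewrite !mulN1r opprD addrACA.
(* With primes for [sub]: P Q - P' Q' = P (Q - Q') + Q' (P - P'). *)
- apply: I1_eq (I1_add (I1_mul (dp_coeffs_evu hP) (IHQ hQ))
      (I1_mul (dp_coeffs_evu (subF hQ)) (IHP hP))).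
    by apply: (@dsubE (DPmul P Q) (sub (DPmul P Q))) => //; apply: (subF (P := DPmul P Q)).
  by move=> b /=; ring.
Qed.

Lemma elim_ideal P : dp_coeffs_in F P ->
  dp_eval (comb (djet D shifted) (djet D eta)) P = 0 -> I1 (evu P).
Proof.
move=> hP e.
suff h : I1 (evu (sub P)).
  apply: I1_eq (I1_add (sub_congr hP) h); first exact: dp_coeffs_evu.
  by move=> b /=; rewrite mulN1r subrK.
set R := sub P; have hR : dp_coeffs_in F R by exact: subF.
have eR : dp_eval (comb (djet D w0) (djet D eta)) R = 0.
  rewrite -[RHS]e dp_eval_dsubst; apply: dp_eval_ext => -[v|w] j _ //=.
  rewrite [in RHS]/djet /shifted; case: (eqVneq v v0) => [_|_]; last by [].
  rewrite /= mulN1r (iterD_add derD) (iterD_opp derD); congr (_ - _).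
  pose z (s : V + W) := match s with inl v => w0 v | inr w => eta w end.
  have zE Q : dp_eval (comb (djet D w0) (djet D eta)) Q = dp_eval (djet D z) Q.
    by apply: dp_eval_ext => -[].
  by rewrite !zE dp_eval_iter_deriv.
pose N := dp_ord R; pose C m := projr (cf (@inlp V W) N R m).
have F0 := dsubfield0 dsF.
have hC m : dp_coeffs_in F (C m).
  by apply: dp_coeffs_projr => //; apply: dp_coeffs_cf => //; exact: (dsubfield_fld dsF).
have IC m : I1 (C m).
  apply/I1_I/genI; rewrite // dp_eval_projr.
  apply: (findep_cf pchar0 m (leqnn N) iw0 hR _ _ eR).
    by move=> c hc; apply/fld_in/dfgen_base.
  by move=> w j; apply/fld_in/dfgen_jet.
(* The coefficients [C m] were found through [w0] but do not involve the coefficient family, so the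
   expansion may now be taken at [u]. *)
have [B [mon [hmon eB]]] := part_expand (@inlp V W) (comb (djet D u) (fun _ _ => 0)) (leqnn N).
have kmon m : K (mon m).
  apply: (dfgen_fld dsF); apply: hmon => -[v|w] j // _.
  by apply/fld_in/dfgen_jet.
apply: (@I1_eq (dp_big (@DPadd E W) 0 (fun m : 'X_{1.._ < B} => DPmul (DPc (mon m)) (C m))
  (enum predT))).
- exact: dp_coeffs_evu.
- move=> b; rewrite dp_eval_bigadd dp_eval_evu big_enum /=.
  transitivity (dp_eval (fun v j => if inlp v then comb (djet D u) (fun _ _ => 0) v j
       else comb (fun _ _ => 0) b v j) R).
    by rewrite eB; apply: eq_bigr => m _; rewrite dp_eval_projr mulrC.
  by apply: dp_eval_ext => -[].
- elim: (enum _) => //= m l IH; apply: I1_add; last exact: IH.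
  by apply: I1_mul; [exact: kmon|exact: IC].
Qed.

End Elimination.

(** * Transcendence degree of jets *)

Section MapPoly.
Variables (E : fieldType) (W : finType) (g : E -> E).
Hypotheses (g0 : g 0 = 0) (g1 : g 1 = 1).

Lemma dp_map_big op op' c (A : Type) (f : A -> dpoly E W) l :
  (forall P Q, dp_map g (op P Q) = op' (dp_map g P) (dp_map g Q)) ->
  dp_map g (dp_big op c f l) = dp_big op' (g c) (dp_map g \o f) l.
Proof. by move=> h; elim: l => //= x l <-; rewrite h. Qed.

Lemma dp_eval_map_poly a (idx : seq (W * nat)) (p : {mpoly E[size idx]}) :
  dp_eval a (dp_map g (poly_dp p)) =
  (mp_map g p).@[fun i => let vj := tnth (in_tuple idx) i in a vj.1 vj.2].
Proof.
rewrite /mp_map raddf_sum /= (dp_map_big _ _ (op' := @DPadd E W)) // g0 dp_eval_bigadd.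
apply: eq_bigr => m _ /=; rewrite mevalZ mevalX (dp_map_big _ _ (op' := @DPmul E W)) // g1.
rewrite dp_eval_bigmul big_enum; congr (_ * _); apply: eq_bigr => i _ /=.
by elim: (m i) => [|k IH] /=; rewrite ?g1 // IH exprS.
Qed.
End MapPoly.

Section RankTransport.
Variables (E : fieldType) (D : E -> E) (F : E -> Prop).
Hypothesis derD : is_derivation D.
Hypothesis pchar0 : [pchar E] =i pred0.
Hypothesis dsF : is_dsubfield D F.
Variables (V W : finType) (x x' : V -> E) (eta eta' : W -> E).
Hypotheses (ix : findep F (jet D x)) (ix' : findep F (jet D x')).
Let K := dfgen D F x.
Let K' := dfgen D F x'.
Hypothesis gen : is_generic_zero D K (sp_ideal D F x x' eta) eta'.

Let sg := sigma D F x x'.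
Let sg' := sigma D F x' x.

(** By genericity [eta'] satisfies [P] exactly when [eta] satisfies the image of [P] under [sigma].
    Relations over the two fields thus correspond through [sigma] and its inverse, applied to
    coefficients. *)
Lemma transport_indep idx : uniq idx ->
  rk K (map (jet D eta') idx) = size idx <-> rk K' (map (jet D eta) idx) = size idx.
Proof.
move=> u; rewrite -!aindep_idx //.
have F0 := dsubfield0 dsF; have F1 := dsubfield1 dsF.
have sg0 : sg 0 = 0 by rewrite /sg sigma_base.
have sg1 : sg 1 = 1 by rewrite /sg sigma_base.
have sg'0 : sg' 0 = 0 by rewrite /sg' sigma_base.
have sg'1 : sg' 1 = 1 by rewrite /sg' sigma_base.
have coefK (y : V -> E) (p : {mpoly E[size idx]}) m : p \is a mpolyOver _ (fldp (dfgen D F y)) ->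
    dfgen D F y p@_m.
  by move=> /mpolyOverP/(_ m)/fldpP; exact: (dfgen_fld dsF).
have overK (y : V -> E) (p : {mpoly E[size idx]}) : (forall m, dfgen D F y p@_m) ->
    p \is a mpolyOver _ (fldp (dfgen D F y)).
  by move=> h; apply/mpolyOverP => m; apply/fldpP/fld_in.
have dpK (y : V -> E) (p : {mpoly E[size idx]}) : (forall m, dfgen D F y p@_m) ->
    dp_coeffs_in (dfgen D F y) (poly_dp p).
  by apply: dp_coeffs_poly_dp; exact: dfgen_base.
split=> h p hp e.
- have ck m : K (mp_map sg' p)@_m.
    by rewrite mcoeff_mp_map //; apply: (sigma_in pchar0 dsF ix' ix); apply: coefK.
  have : mp_map sg' p = 0.
    apply: h; first exact: overK.
    rewrite -[LHS](dp_eval_poly_dp (djet D eta')); apply/(gen (dpK _ _ ck)).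
    split; first exact: dpK.
    rewrite dp_eval_map_poly // -[RHS]e; congr (_.@[_]); apply/mpolyP => m.
    by rewrite !mcoeff_mp_map // /sg /sg' sigmaK //; exact: coefK.
  move=> e0; apply/mpolyP => m; rewrite mcoeff0.
  have := congr1 (fun q : {mpoly E[size idx]} => sg q@_m) e0.
  by rewrite mcoeff0 mcoeff_mp_map // /sg' /sg (sigmaK pchar0 dsF ix' ix (coefK _ _ m hp))
    sigma_base.
- have ck m : K p@_m by exact: coefK.
  have [_] := (gen (dpK _ _ ck)).2 (etrans (dp_eval_poly_dp _ _) e).
  rewrite dp_eval_map_poly // => e1.
  have e0 : mp_map sg p = 0.
    apply: h e1; apply: overK => m; rewrite mcoeff_mp_map //.
    exact: (sigma_in pchar0 dsF ix ix' (ck m)).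
  apply/mpolyP => m; rewrite mcoeff0.
  have := congr1 (fun q : {mpoly E[size idx]} => sg' q@_m) e0.
  by rewrite mcoeff0 mcoeff_mp_map // /sg' /sg (sigmaK pchar0 dsF ix ix' (ck m)) sigma_base.
Qed.

(** A rank is attained by an independent sublist ([rk_basis]), so preserving independence bounds the
    rank. *)
Lemma rk_transfer (T : eqType) (X Y : E -> Prop) (f f' : T -> E) :
  (forall idx, uniq idx -> rk X (map f idx) = size idx -> rk Y (map f' idx) = size idx) ->
  forall idx, uniq idx -> (rk X (map f idx) <= rk Y (map f' idx))%N.
Proof.
move=> h idx u; have [t [/subseqP[m sm ->] rt <-]] := rk_basis X (map f idx).
rewrite -map_mask in rt *; rewrite size_map in rt *.
rewrite -(h _ (mask_uniq u m) rt); apply: rk_subset => z /mapP[w hw ->].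
by rewrite map_f // (mem_mask hw).
Qed.

Lemma transport_rk idx : uniq idx -> rk K (map (jet D eta') idx) = rk K' (map (jet D eta) idx).
Proof.
move=> u; apply/eqP; rewrite eqn_leq; apply/andP; split; apply: rk_transfer => // l ul.
  by move/(transport_indep ul).
by move/(transport_indep ul).
Qed.

End RankTransport.

(** * Linear growth of jets and the differential transcendence degree *)

Section Growth.
Variables (E : fieldType) (D : E -> E) (K : E -> Prop).
Hypothesis derD : is_derivation D.
Hypothesis pchar0 : [pchar E] =i pred0.
Hypothesis dsK : is_dsubfield D K.

Definition djets (l : seq E) (N : nat) : seq E :=
  flatten [seq map (iter j D) l | j <- iota 0 N].

Lemma djetsP l N z :
  reflect (exists j a, [/\ (j < N)%N, a \in l & z = iter j D a]) (z \in djets l N).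
Proof.
apply: (iffP flatten_mapP) => [[j hj /mapP[a ha ->]]|[j [a [hj ha ->]]]].
  by exists j, a; rewrite mem_iota in hj.
by exists j; rewrite ?mem_iota // map_f.
Qed.

Lemma mem_iterD a j N : (j < N)%N -> iter j D a \in [seq iter i D a | i <- iota 0 N].
Proof. by move=> hj; apply/mapP; exists j; rewrite ?mem_iota. Qed.

Lemma size_djets l N : size (djets l N) = (size l * N)%N.
Proof.
rewrite size_flatten /shape -map_comp (eq_map (g := fun=> size l)); last by move=> j /=;
  rewrite size_map.
elim: N {1}0%N => [|N IH] k; first by rewrite muln0.
by rewrite /= IH mulnS.
Qed.

Lemma dindepP l : dindep D K l <-> forall N, rk K (djets l N) = (size l * N)%N.
Proof.
have Ks a : fld K a -> K a by exact: (dsubfield_fld dsK).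
by split=> h N; have := h N; rewrite alg_indepP // -/(djets l N) size_djets.
Qed.

(** Elements of [l] are kept greedily while the kept ones stay differentially independent. For a
    rejected [a], some derivative is algebraic over lower derivatives of [a] and jets of [B];
    differentiating, so are all later ones, and [a] adds only a bounded amount to the rank. *)
Lemma growth_basis l : exists (B : seq E) (C : nat), [/\ {subset B <= l}, dindep D K B &
  forall N, (rk K (djets l N) <= size B * N + C)%N].
Proof.
elim: l => [|a l [B [C [sB iB hC]]]].
  have nil N : djets [::] N = [::] by apply/nilP; rewrite /nilp size_djets.
  by exists [::], 0%N; split=> // [|N]; [apply/dindepP => N|]; rewrite nil.
have [i'|ni] := excluded_middle_informative (dindep D K (a :: B)).
  exists (a :: B), C; split=> // [z|N].
    by rewrite !inE => /orP[->//|/sB ->]; rewrite orbT.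
  apply: leq_trans (_ : rk K ([seq iter j D a | j <- iota 0 N] ++ djets l N) <= _)%N.
    apply: rk_subset => z /djetsP[j [b [hj]]]; rewrite inE mem_cat => /orP[/eqP->|hb] ->.
      by rewrite mem_iterD.
    by apply/orP; right; apply/djetsP; exists j, b.
  apply: leq_trans (rk_cat_le _ _ _) _; rewrite /= mulSn -addnA leq_add //.
  by apply: leq_trans (rk_le_size _ _) _; rewrite size_map size_iota.
have [N0 hN0] : exists N, rk K (djets (a :: B) N) <> (size (a :: B) * N)%N.
  apply: NNPP => h; apply: ni; apply/dindepP => N.
  by apply: NNPP => hN; apply: h; exists N.
pose Z M m : E -> Prop := fun z => addl K (djets B M) z \/ exists2 i, (i < m)%N & z = iter i D a.
(* Otherwise each derivative of [a] would be new over the previous ones and the [N0] first jets of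
   [B], and [chain_rk] would contradict [hN0]. *)
have [j0 hj0] : exists j, cl (Z N0 j) (iter j D a).
  apply: NNPP => h; apply: hN0.
  have -> : rk K (djets (a :: B) N0) = rk K (djets B N0 ++ [seq iter j D a | j <- iota 0 N0]).
    apply/eqP; rewrite eqn_leq; apply/andP; split; apply: rk_subset => z.
      case/djetsP=> j [b [hj]]; rewrite inE mem_cat => /orP[/eqP->|hb] ->.
        by rewrite [X in _ || X]mem_iterD ?orbT.
      by apply/orP; left; apply/djetsP; exists j, b.
    rewrite mem_cat => /orP[/djetsP[j [b [hj hb ->]]]|/mapP[j hj ->]]; apply/djetsP.
      by exists j, b; rewrite inE hb orbT.
    by exists j, a; rewrite mem_iota in hj; rewrite mem_head.
  rewrite rk_cat (dindepP B).1 //= (chain_rk (Y := Z N0) (v := fun j => iter j D a)).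
  - by rewrite mulSn addnC.
  - by move=> j _ hj; apply: h; exists j.
  - by move=> i j b le_ij [|[m hm ->]]; [left|right; exists m => //; exact: leq_trans le_ij].
  - by move=> j; apply: cl_in; right; exists j.
  - by move=> b hb; apply: cl_in; left.
(* Differentiating k times costs k more jets of [B], but the derivatives of [a] from order [j0] on
   are eliminated by induction, so only those below [j0] remain. *)
have hj (k : nat) : cl (Z (N0 + k)%N j0) (iter (j0 + k)%N D a).
  elim: k {-2}k (leqnn k) => [|k IH] m.
    by rewrite leqn0 => /eqP->; rewrite !addn0.
  rewrite leq_eqVlt => /orP[/eqP->|]; last by rewrite ltnS; exact: IH.
  have mono M M' b : (M <= M')%N -> Z M j0 b -> Z M' j0 b.
    move=> hM [[hb|/djetsP[j [c [hj hc ->]]]]|hb]; [by left; left| |by right].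
    by left; right; apply/djetsP; exists j, c; rewrite (leq_trans hj).
  have step : cl (Z (N0 + k.+1) (j0 + k.+1))%N (iter (j0 + k.+1)%N D a).
    rewrite [X in iter X]addnS /=; apply: (cl_der derD pchar0 _ _ (IH k (leqnn k))) => b.
      case=> [[hb|/djetsP[j [c [hj hc ->]]]]|[i hi ->]]; apply: fld_in; [by left; left| |].
        by left; right; apply/djetsP; exists j, c; rewrite addnS ltnS ltnW.
      by right; exists i => //; lia.
    case=> [[hb|/djetsP[j [c [hj hc ->]]]]|[i hi ->]]; apply: fld_in.
    - by left; left; exact: (dsubfield_der dsK).
    - by left; right; apply/djetsP; exists j.+1, c; rewrite addnS ltnS.
    - by right; exists i.+1 => //; lia.
  apply: cl_trans step => b [hb|[i hi ->]]; first by apply: cl_in; left.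
  have [lt_i|ge_i] := ltnP i j0; first by apply: cl_in; right; exists i.
  have := IH (i - j0)%N; rewrite subnKC // => h.
  have {h} : cl (Z (N0 + (i - j0))%N j0) (iter i D a) by apply: h; lia.
  by apply: cl_mono => c; apply: mono; lia.
(* [j0] counts the lower derivatives of [a], [size B * N0] pays for the shift of the jets by [N0],
   and [C] comes from the tail of the list. *)
exists B, (j0 + size B * N0 + C)%N; split=> //.
  by move=> z /sB hz; rewrite inE hz orbT.
move=> N; apply: leq_trans (_ : rk K ([seq iter i D a | i <- iota 0 j0] ++ djets l (N0 + N)%N)
  <= _)%N.
  apply: rk_sub => z /djetsP[j [b [hjN]]]; rewrite inE => /orP[/eqP->|hb] ->; last first.
    apply: cl_in; right; rewrite mem_cat; apply/orP; right; apply/djetsP; exists j, b.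
    by rewrite (leq_trans hjN) // leq_addl.
  have [lt_j|ge_j] := ltnP j j0.
    by apply: cl_in; right; rewrite mem_cat mem_iterD.
  have := hj (j - j0)%N; rewrite subnKC //;
    apply: cl_mono => c [[hc|/djetsP[i [e [hi he ->]]]]|[i hi ->]].
  - by left.
  - right; rewrite mem_cat; apply/orP; right; apply/djetsP; exists i, e; rewrite sB //.
    by split=> //; lia.
  - by right; rewrite mem_cat mem_iterD.
apply: leq_trans (rk_cat_le _ _ _) _.
have h1 := rk_le_size K [seq iter i D a | i <- iota 0 j0]; rewrite size_map size_iota in h1.
have h2 := hC (N0 + N)%N.
by apply: leq_trans (leq_add h1 h2) _; rewrite mulnDr; lia.
Qed.

Lemma fld_iter_der (X : nat -> E -> Prop) a k : (forall j b, X j b -> X j.+1 b) ->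
  (forall j b, X j b -> X j.+1 (D b)) -> fld (X 0%N) a -> fld (X k) (iter k D a).
Proof.
move=> h1 h2 ha; elim: k => //= k IH; apply: fld_der IH => // b hb; apply: fld_in; auto.
Qed.

Variables (n : nat) (y : 'I_n -> E) (d h T : nat).
Hypothesis growth : forall t, (T <= t)%N -> rk K (djets [seq y i | i <- enum 'I_n] t) =
  (d * t + h)%N.

(** Comparison of slopes. An independent list [t] in the field generated by jets of order below [q]
    satisfies [size t * N <= d * (q + N) + h], so [size t <= d]; the list from [growth_basis] has
    slope at least [d]. *)
Lemma dtrdeg_of_growth : dtrdeg D K (dfgen D K y) d.
Proof.
pose X q := extx K (jet D y) (fun ij => (ij.2 < q)%N).
have upper (t : seq E) : (forall z, z \in t -> dfgen D K y z) -> dindep D K t -> (size t <= d)%N.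
  move=> ht /dindepP it.
  have [q hq] : exists q, forall z, z \in t -> fld (X q) z.
    elim: t ht {it} => [|z t IH] ht; first by exists 0%N.
    have [|q hq] := IH; first by move=> w hw; apply: ht; rewrite inE hw orbT.
    have [P [Q [hP hQ _ ez]]] := ht z (mem_head _ _).
    have mono q1 q2 b : (q1 <= q2)%N -> fld (X q1) b -> fld (X q2) b.
      move=> le; apply: fld_mono => c [hc|[ij hij ->]]; apply: fld_in; first by left.
      by right; exists ij => //; exact: leq_trans le.
    exists (maxn q (maxn (dp_ord P) (dp_ord Q))) => w; rewrite inE => /orP[/eqP->|/hq]; last first.
      by apply: mono; exact: leq_maxl.
    have hR R : dp_coeffs_in K R -> fld (X (dp_ord R)) (dp_eval (djet D y) R).
      apply: dp_eval_fld => [c hc|v j hj]; apply: fld_in; first by left.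
      by right; exists (v, j).
    rewrite ez; apply: fldM; last apply: fldV.
      by apply: mono (hR P hP); rewrite !leq_max leqnn ?orbT.
    by apply: mono (hR Q hQ); rewrite !leq_max leqnn ?orbT.
  (* Large enough that [N] exceeds the constant [d * q + h] and that [growth] applies. *)
  pose N := (d * q + h + T).+1.
  have : (size t * N <= d * (q + N) + h)%N.
    rewrite -it -growth; last by rewrite /N; lia.
    apply: rk_sub => z /djetsP[j [b [hj hb ->]]]; apply: cl_fld.
    have : fld (X (q + j)%N) (iter j D b).
      have := @fld_iter_der (fun j => X (q + j)%N) b j _ _; apply.
      - by move=> i c [hc|[ij hij ->]]; [left|right; exists ij => //; rewrite addnS ltnS ltnW].
      - move=> i c [hc|[[v k] hij ->]]; first by left; exact: (dsubfield_der dsK).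
        by right; exists (v, k.+1) => //=; rewrite addnS ltnS.
      - by rewrite addn0; exact: hq.
    apply: fld_mono => c [hc|[[v k] hij ->]]; apply: fld_in; first by left.
    right; apply/djetsP; exists k, (y v); rewrite map_f ?mem_enum //; split=> //.
    by rewrite /= in hij; lia.
  move=> hle; rewrite leqNgt; apply/negP => lt.
  have : (d.+1 * N <= size t * N)%N by rewrite leq_mul2r lt orbT.
  by rewrite mulnDr mulSn /N in hle *; lia.
split=> //; have [B [C [sB iB hC]]] := growth_basis [seq y i | i <- enum 'I_n].
have hB z : z \in B -> dfgen D K y z.
  by move=> /sB /mapP[i _ ->]; exact: (dfgen_jet dsK y i 0).
exists B; split=> //; apply/eqP; rewrite eqn_leq upper //=.
(* Now [N] has to exceed [C], the constant in the upper bound. *)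
pose N := (C + T).+1; have := hC N; rewrite growth; last by rewrite /N; lia.
move=> hle; rewrite leqNgt; apply/negP => lt.
have : ((size B).+1 * N <= d * N)%N by rewrite leq_mul2r lt orbT.
by rewrite mulSn /N in hle *; lia.
Qed.

End Growth.

(** * The jets of the modified family *)

Section Shift.
Variable E : fieldType.
Implicit Types (S T : E -> Prop) (P : E -> Prop).

(** Converse of [cl_addxP]. *)
Lemma ev2_cl S (P : {poly {poly fldt S}}) u v i : ev2 P u v = 0 ->
  (map_poly (fval S) P`_i).[u] != 0 -> cl (addx S u) v.
Proof.
move=> e hi; pose Q := map_poly (fun p : {poly fldt S} => (map_poly (fval S) p).[u]) P.
have Qk k : Q`_k = (map_poly (fval S) P`_k).[u].
  by rewrite /Q coef_poly; case: ltnP => // hk; rewrite nth_default // rmorph0 horner0.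
exists Q; split; last exact/rootP.
- by apply: contraNneq hi => Q0; rewrite -Qk Q0 coef0.
- move=> k; rewrite Qk horner_coef; apply: fld_sum => j _; apply: fldM.
    by rewrite coef_map; apply: (fld_mono _ (fval_fld _)) => z hz; apply: fld_in; left.
  by apply: fldX; apply: fld_in; right.
Qed.

(* Being transcendental over [T], [c] may be replaced by [c + 1] in an equation for [w - c e];
   subtracting the two values shows that [e] is algebraic over [S(c)]. *)
Lemma cl_shift S T c e w : (forall b, S b -> T b) -> fld T e -> fld T w -> ~ cl T c ->
  cl (addx S c) (w - c * e) -> cl S e.
Proof.
move=> ST fe fw nc hc; apply: NNPP => ne.
have hS b : fld S b -> fld T b by apply: fld_mono => z /ST/fld_in.
have {}ne : ~ cl (addx S c) e.
  move=> h; apply: nc; apply: cl_trans (cl_exchange h ne) => b [/ST/cl_in|->] //.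
  exact: cl_fld.
have [P [P0 [i hi]]] := cl_addxP hc.
apply: ne.
have -> : e = (w - c * e) - (w - (c + 1) * e) by ring.
apply: clB => //.
suff h : cl (addx S (c + 1)) (w - (c + 1) * e).
  apply: cl_trans h => b [hb|->]; first by apply: cl_in; left.
  by apply: clD; [apply: cl_in; right|exact: cl1].
pose Q := \sum_(i < size P) map_poly (fval S) P`_i * (w%:P - e *: 'X) ^+ i.
have QE t : Q.[t] = ev2 P t (w - t * e).
  rewrite ev2E /Q horner_sum; apply: eq_bigr => j _.
  by rewrite hornerM horner_exp !hornerE [e * t]mulrC.
(* [Q] is P(t, w - t e) as a polynomial in t; its coefficients lie in [fld T], over which its root
   [c] is transcendental. *)
have Q0 : Q = 0.
  apply: NNPP => /eqP nQ; apply: nc; exists Q; split=> //; last by apply/rootP; rewrite QE.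
  have over (R : {poly E}) : (forall k, fld T R`_k) <-> R \is a polyOver (fldp T).
    split=> [h|/polyOverP h k]; first by apply/polyOverP => k; apply/fldpP.
    exact/fldpP.
  apply/over; rewrite rpred_sum // => j _; rewrite rpredM //.
    by apply/over => k; rewrite coef_map; apply: hS; exact: fval_fld.
  rewrite rpredX // rpredB ?polyOverC ?polyOverZ ?polyOverX //; exact/fldpP.
apply: (@ev2_cl _ P _ _ i); first by rewrite -QE Q0 horner0.
apply: contraT; rewrite negbK => /eqP h.
case: nc; suff hc1 : cl T (c + 1).
  by rewrite -(addrK 1 c); apply: clB => //; exact: cl1.
exists (map_poly (fval S) P`_i); split; last exact/rootP.
  by apply: contraNneq hi => ->; rewrite horner0.
by move=> k; rewrite coef_map; apply: hS; exact: fval_fld.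
Qed.

End Shift.

Section Leibniz.
Variables (E : fieldType) (D : E -> E).
Hypothesis derD : is_derivation D.

Lemma fld_iterM (Z : E -> Prop) k a b :
  (forall j, (j <= k)%N -> fld Z (iter j D a)) -> (forall j, (j <= k)%N -> fld Z (iter j D b)) ->
  fld Z (iter k D (a * b)).
Proof.
elim: k a b => [|k IH] a b ha hb; first by apply: fldM; [apply: (ha 0%N)|apply: (hb 0%N)].
rewrite iterSr (derM derD) (iterD_add derD); apply: fldD; apply: IH => j hj;
  rewrite -?iterSr; [exact: ha|exact: hb (leqW hj)|exact: ha (leqW hj)|exact: hb].
Qed.

(** Isolates the one term of the Leibniz formula in which [a] is not differentiated, without writing
    binomial coefficients. *)
Lemma iterM_split (Z : E -> Prop) k a b :
  (forall j, (0 < j <= k)%N -> fld Z (iter j D a)) -> (forall j, (j < k)%N -> fld Z (iter j D b)) ->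
  fld Z (iter k D (a * b) - a * iter k D b).
Proof.
elim: k b => [|k IH] b ha hb; first by rewrite subrr; exact: fld0.
rewrite iterSr (derM derD) (iterD_add derD) -addrA; apply: fldD.
  by apply: fld_iterM => j hj; rewrite -?iterSr; [exact: ha|exact: hb].
rewrite iterSr; apply: IH => j hj; first by apply: ha; lia.
by rewrite -iterSr; exact: hb.
Qed.

End Leibniz.

Section Order.
Variables (E : fieldType) (D : E -> E) (F : E -> Prop).
Hypothesis derD : is_derivation D.
Hypothesis pchar0 : [pchar E] =i pred0.
Hypothesis dsF : is_dsubfield D F.
Variables (V W : finType) (w0 : V -> E) (v0 m0 : V) (eta : W -> E) (mon : V -> E) (s : nat).
Let G := dfgen D F eta.
Hypothesis iw0 : findep G (jet D w0).
Hypothesis ne_m0 : m0 != v0.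
Let Eb j := extx F (jet D eta) (fun ij => (ij.2 < j)%N).
Hypothesis mon_ord : forall v, fld (Eb s.+1) (mon v).
Variable i0 : W.
Hypothesis mon_m0 : mon m0 = djet D eta i0 s.
Let A (vj : V * nat) : Prop := vj.1 != v0.
Let w1 : E := - \sum_(v | v != v0) w0 v * mon v.
Let X := extx F (jet D w0) A.
(** The tower for [chain_rk]: the [k]-th derivative of [w1] lies in level [k.+1] ([v_in]) and, when
    d > 0, is transcendental over level [k] ([v_notin]). *)
Let Y k := extx (Eb (k + s)%N) (jet D w0) A.
Let v k := iter k D w1.
Let L t := map (jet D eta) (jidx W t).

Lemma Eb_mono j k b : (j <= k)%N -> Eb j b -> Eb k b.
Proof. by move=> le [hb|[ij h ->]]; [left|right; exists ij => //; exact: leq_trans le]. Qed.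

Lemma Eb_der j b : Eb j b -> Eb j.+1 (D b).
Proof.
by case=> [hb|[[i k] h ->]]; [left; exact: (dsubfield_der dsF)|right; exists (i, k.+1)].
Qed.

Lemma Eb_G j b : Eb j b -> cl G b.
Proof.
case=> [hb|[[i k] _ ->]]; apply: cl_in; first exact: dfgen_base.
exact: dfgen_jet.
Qed.

Lemma Y_mono i j b : (i <= j)%N -> Y i b -> Y j b.
Proof.
by move=> le [hb|hb]; [left; apply: Eb_mono hb; rewrite leq_add2r|right].
Qed.

Lemma X_Y k b : X b -> Y k b.
Proof. by case=> hb; [left; left|right]. Qed.

Lemma v_in k : fld (Y k.+1) (v k).
Proof.
apply: (@fld_iter_der _ D derD (fun j => Y j.+1)).
- by move=> j b; exact: Y_mono.
- move=> j b [hb|[[i l] h ->]]; first by left; apply: Eb_der.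
  by right; exists (i, l.+1).
apply/fldN/fld_sum => i hi; apply: fldM.
  by apply: fld_in; right; exists (i, 0%N).
by apply: fld_mono (mon_ord i) => b hb; apply: fld_in; left; rewrite add1n.
Qed.

(** Separate the indices by entry: the unmodified entries are independent as part of [w0], and over
    all of them the derivatives of [w1] are independent by [chain_findep]. *)
Lemma shifted_rank (z : V -> E) : (forall u, z u = if u == v0 then w1 else w0 u) ->
  (forall k, ~ cl (Y k) (v k)) -> findep F (jet D z).
Proof.
move=> zE hv idx u.
have iF : findep F (jet D w0) by apply: (findep_anti iw0) => b hb; apply/cl_in/dfgen_base.
pose p (vj : V * nat) := vj.1 != v0; pose l1 := filter p idx; pose l2 := filter (predC p) idx.
have pl : perm_eq (l1 ++ l2) idx by rewrite perm_filterC.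
rewrite -(perm_size pl) -(rk_perm _ (perm_map _ pl)) map_cat rk_cat size_cat.
have e1 : map (jet D z) l1 = map (jet D w0) l1.
  apply/eq_in_map => -[i j]; rewrite mem_filter => /andP[hi _].
  by rewrite /jet /= zE (negPf hi).
congr addn; first by rewrite e1 iF // filter_uniq.
have iv : findep X (fun j => v (0 + j)%N).
  apply: (chain_findep (Y := Y)) => //; [exact: Y_mono|by move=> j; apply/cl_fld/v_in|].
  by move=> b hb; apply/cl_in/X_Y.
have {}iv : findep (addl F (map (jet D z) l1)) (fun j => v (0 + j)%N).
  apply: (findep_anti iv) => b [hb|]; first by apply: cl_in; left.
  rewrite e1 => /mapP[vj hvj ->]; apply: cl_in; right; exists vj => //.
  by move: hvj; rewrite mem_filter => /andP[].
have e2 : map (jet D z) l2 = map (fun j => v (0 + j)%N) (map snd l2).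
  rewrite -map_comp; apply/eq_in_map => -[i j]; rewrite mem_filter => /andP[/negPn/eqP /= -> _].
  by rewrite /jet /= zE eqxx.
rewrite e2 iv ?size_map // map_inj_in_uniq ?filter_uniq // => -[i j] [i' j'].
by rewrite !mem_filter => /andP[/negPn/eqP /= -> _] /andP[/negPn/eqP /= -> _] ->.
Qed.

Lemma rk_X t : rk X (L t) = rk F (L t).
Proof.
apply: (findep_rk iw0) => [b hb|b /mapP[[i j] _ ->]]; apply: cl_in.
  exact: dfgen_base.
exact: dfgen_jet.
Qed.

Lemma Y_L k t b : (k + s <= t)%N -> Y k b -> addl X (L t) b.
Proof.
move=> le [[hb|[[i j] hj ->]]|hb]; [by left; left| |by left; right].
by right; rewrite map_f // mem_jidx; apply: leq_trans le.
Qed.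

(** The bound behind the case d = 0: derivatives of [w1] lie in the field of the other coefficients
    and the jets of [eta], whose rank those coefficients leave unchanged. *)
Lemma rk_v_le N t : (N + s <= t)%N -> (rk X (map v (iota 0 N)) <= rk F (L t))%N.
Proof.
move=> le; rewrite -rk_X; apply: rk_sub => b /mapP[k]; rewrite mem_iota /= add0n => hk ->.
apply: cl_mono (cl_fld (v_in k)) => c; apply: Y_L.
by apply: leq_trans le; rewrite leq_add2r.
Qed.

Hypothesis trans_i0 : forall j, ~ cl (Eb j) (jet D eta (i0, j)).

Lemma v_notin k : ~ cl (Y k) (v k).
Proof.
(* Besides the jets of [v0], only [w0 m0] itself is left out; its proper derivatives may occur in
   the remainder. *)
move=> h; pose B (vj : V * nat) := (vj.1 != v0) && (vj != (m0, 0%N)).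
pose S j := extx (Eb (j + s)%N) (jet D w0) B.
have SS j b : S j b -> S j.+1 b by case=> hb; [left; apply: Eb_mono hb; rewrite leq_add2r|right].
pose e := jet D eta (i0, (k + s)%N).
have etaE j : iter j D (djet D eta i0 s) = jet D eta (i0, (j + s)%N) by rewrite /jet iterD.
have monS u j : (j <= k)%N -> fld (S k.+1) (iter j D (mon u)).
  move=> hj; have := @fld_iter_der _ D derD (fun j => Eb (j + s.+1)%N) (mon u) j _ _.
  move=> /(_ (fun i b => @Eb_mono _ _ b (leqnSn _)) (fun i b => @Eb_der _ b) (mon_ord u)).
  by apply: fld_mono => b hb; apply: fld_in; left; apply: Eb_mono hb; lia.
have wS u j : B (u, j) -> fld (S k.+1) (iter j D (w0 u)).
  by move=> hB; apply: fld_in; right; exists (u, j).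
have [w fw vE] : exists2 w, fld (S k.+1) w & v k = w - w0 m0 * e.
  pose w := - (iter k D (w0 m0 * mon m0) - w0 m0 * iter k D (mon m0)) -
    \sum_(u | (u != v0) && (u != m0)) iter k D (w0 u * mon u).
  exists w.
    apply: fldB; [apply: fldN|apply: fld_sum => u /andP[h1 h2]].
      apply: (iterM_split derD) => j hj; last by apply: monS; exact: ltnW.
      by apply: wS; rewrite /B /= ne_m0 xpair_eqE negb_and; apply/orP; right; case: j hj.
    apply: (fld_iterM derD) => j hj; last exact: monS.
    by apply: wS; rewrite /B /= h1 xpair_eqE negb_and h2.
  have itS (J : finType) (P : pred J) f : iter k D (\sum_(u | P u) f u) =
    \sum_(u | P u) iter k D (f u).
    by apply: big_morph; [exact: iterD_add|exact: iterD0].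
  rewrite /v /w1 (iterD_opp derD) itS (bigD1 m0) //= /w mon_m0 etaE -/e.
  by rewrite opprB opprD addrAC [in RHS]addrAC; ring.
have {}h : cl (addx (S k) (w0 m0)) (w - w0 m0 * e).
  rewrite -vE; apply: cl_mono h => b [hb|[vj hvj ->]]; first by left; left.
  have [->|ne] := eqVneq vj (m0, 0%N); first by right.
  by left; right; exists vj; rewrite // /B ne andbT.
have : cl (S k) e.
  apply: cl_shift h; [exact: SS| |exact: fw|].
  - by apply: fld_in; left; right; exists (i0, (k + s)%N) => //=; rewrite addSn.
  - move=> hc; apply: (findep_notin iw0 (A := B) (t := (m0, 0%N))).
      by rewrite /B eqxx andbF.
    apply: cl_trans hc => b [/Eb_G|hb]; last by apply: cl_in; right.
    by apply: cl_mono => c; left.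
move/(findep_cl iw0 (@Eb_G _)) => h2; apply: (trans_i0 (j := (k + s)%N)); apply: h2.
by apply/cl_in/dfgen_jet.
Qed.

(** The first t - s derivatives of [w1] lie in the field generated over [X] by the jets in [L t] and
    have full rank, so adjoining them lowers the rank of [L t] by exactly t - s. Here [t] counts the
    orders below [t]. *)
Lemma rk_order t (z : V -> E) d h : (forall u, z u = if u == v0 then w1 else w0 u) ->
  (0 < d)%N -> (s <= t)%N -> rk F (L t) = (d * t + h)%N ->
  rk (dfgen D F z) (L t) = (d.-1 * t + (h + s))%N.
Proof.
move=> zE d_gt0 le_st rkL; pose N := (t - s)%N; pose Vl := map v (iota 0 N).
have Ns : (N + s = t)%N by rewrite subnK.
have vY j : cl (Y j.+1) (v j) by apply/cl_fld/v_in.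
have rkV : rk X Vl = N.
  apply: (chain_rk (Y := Y)) => // [j _|i j b|b hb]; [exact: v_notin|exact: Y_mono|].
  exact/cl_in/X_Y.
have VlY b : b \in Vl -> cl (Y N) b.
  case/mapP=> j; rewrite mem_iota add0n /= => hj ->; apply: cl_mono (vY j) => c; exact: Y_mono.
have e1 : (rk X (L t) = N + rk (addl X Vl) (L t))%N.
  rewrite -rkV -rk_cat (rk_perm _ (permEl (perm_catC Vl (L t)))) rk_cat.
  suff -> : rk (addl X (L t)) Vl = 0%N by rewrite addn0.
  by apply/rk0P => b /VlY; apply: cl_mono => c; apply: Y_L; rewrite Ns.
have e2 : rk (dfgen D F z) (L t) = rk (addl X Vl) (L t).
  (* The later derivatives are independent over a level that already contains [L t], so they do not
     affect its rank. *)
  have iN : findep (Y N) (fun j => v (N + j)%N).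
    apply: (chain_findep (Y := Y)) => //; [exact: v_notin|exact: Y_mono|].
    by move=> b; exact: cl_in.
  have <- : rk (extx (addl X Vl) (fun j => v (N + j)%N) (fun=> True)) (L t) = rk (addl X Vl) (L t).
    apply: (findep_rk iN) => [b [hb|/VlY//]|b /mapP[[i j]]]; first exact/cl_in/X_Y.
    rewrite mem_jidx => hj ->; apply: cl_in; left; right.
    by exists (i, j) => //=; rewrite Ns.
  apply: rk_eq => b.
    move/dfgen_sub=> h0; apply: cl_fld; apply: fld_mono h0 => c.
    case=> [hc|[[u j] _ ->]]; first by apply: fld_in; do 3 left.
    rewrite /jet /= zE; case: eqP => [_|/eqP ne].
      have [lt|ge] := ltnP j N.
        by apply: fld_in; left; right; rewrite /Vl (map_f v) // mem_iota.
      by apply: fld_in; right; exists (j - N)%N; rewrite // subnKC.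
    by apply: fld_in; left; left; right; exists (u, j).
  have vz j : cl (dfgen D F z) (v j).
    by apply: cl_in; have := dfgen_jet dsF z v0 j; rewrite /djet zE eqxx.
  case=> [[[hb|[[u j] hu ->]]|/mapP[j _ ->]]|[j _ ->]] //.
    by apply: cl_in; exact: dfgen_base.
  by apply: cl_in; have := dfgen_jet dsF z u j; rewrite /djet zE (negPf hu).
have := rk_X t; rewrite rkL e1 -e2 => e3.
have : (N + rk (dfgen D F z) (L t) + s = d * t + h + s)%N by rewrite e3.
have -> : (d * t = d.-1 * t + t)%N by rewrite -{1}(prednK d_gt0) mulSn addnC.
lia.
Qed.

End Order.

Section Transcendental.
Variables (E : fieldType) (D : E -> E) (F : E -> Prop).
Hypothesis derD : is_derivation D.
Hypothesis pchar0 : [pchar E] =i pred0.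
Hypothesis dsF : is_dsubfield D F.
Variables (W : finType) (eta : W -> E).

(** Once a derivative of [eta i] is algebraic over lower jets, so are all later ones. If this
    happened for every i, a common order [M] would make all jets algebraic over those of order below
    [M], and the rank would be bounded. *)
Lemma exists_transcendental d h T : (0 < d)%N ->
  (forall t, (T <= t)%N -> rk F (map (jet D eta) (jidx W t)) = (d * t + h)%N) ->
  exists i0, forall j, ~ cl (extx F (jet D eta) (fun ij => (ij.2 < j)%N)) (jet D eta (i0, j)).
Proof.
move=> d_gt0 growth; apply: NNPP => hno.
pose Eb j := extx F (jet D eta) (fun ij => (ij.2 < j)%N).
have alg i : exists j, cl (Eb j) (jet D eta (i, j)).
  by apply: NNPP => hi; apply: hno; exists i => j hj; apply: hi; exists j.
have up i j k : cl (Eb j) (jet D eta (i, j)) -> (j <= k)%N -> cl (Eb k) (jet D eta (i, k)).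
  move=> hj /subnK <-; elim: (k - j)%N => {k} [|k IH] //; rewrite addSn.
  apply: (cl_der derD pchar0 _ _ IH) => b.
    case=> [hb|[ij hij ->]]; apply: fld_in; [by left|right; exists ij => //; exact: ltnW].
  case=> [hb|[[i' l] hl ->]]; apply: fld_in; [left; exact: (dsubfield_der dsF)|right].
  by exists (i', l.+1).
have [M hM] : exists M, forall i, i \in enum W -> cl (Eb M) (jet D eta (i, M)).
  elim: (enum W) => [|i l [M hM]]; first by exists 0%N.
  have [j hj] := alg i; exists (maxn j M) => i'; rewrite inE => /orP[/eqP->|/hM hi].
    by apply: up hj _; exact: leq_maxl.
  by apply: up hi _; exact: leq_maxr.
pose LM := map (jet D eta) (jidx W M).
have inM k i : cl (addl F LM) (jet D eta (i, k)).
  elim/ltn_ind: k i => k IH i; have [lt|ge] := ltnP k M.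
    by apply: cl_in; right; rewrite map_f // mem_jidx.
  have := up i M k (hM i (mem_enum _ i)) ge; apply: cl_trans => b [hb|[[i' l] hl ->]].
    by apply: cl_in; left.
  exact: IH.
pose t := (size LM + T).+1.
have := growth t; have : (rk F (map (jet D eta) (jidx W t)) <= size LM)%N.
  apply: leq_trans (rk_le_size F LM); apply: rk_sub => b /mapP[[i j] _ ->]; exact: inM.
move=> h1 h2; move: h1; rewrite h2; last by rewrite /t; lia.
by case: d d_gt0 {growth h2} => // d' _; rewrite mulSn /t; lia.
Qed.

End Transcendental.

(** * Generic differential polynomials *)

Section GeneratedIdeal.
Variables (E : fieldType) (D : E -> E) (K : E -> Prop) (V : Type).
Hypothesis dsK : is_dsubfield D K.
Variable S : dpoly E V -> Prop.
Let J := dideal_gen D K S.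
Let K0 := dsubfield0 dsK.
Let K1 := dsubfield1 dsK.

Lemma dideal_gen0 : J (DPc 0).
Proof. by split=> //; exists [::]. Qed.

Lemma dideal_gen_eq P Q : dp_coeffs_in K Q -> dp_eq P Q -> J P -> J Q.
Proof. by move=> hQ e [_ [l [hl el]]]; split=> //; exists l; split=> // a; rewrite -e. Qed.

Lemma dideal_gen_add P Q : J P -> J Q -> J (DPadd P Q).
Proof.
case=> hP [l1 [h1 e1]] [hQ [l2 [h2 e2]]]; split; first by split.
exists (l1 ++ l2); split; first by elim: l1 h1 {e1} => //= t l IH [h /IH].
move=> a; rewrite /= e1 e2; elim: l1 {h1 e1} => [|t l IH] /=; first by rewrite add0r.
by rewrite -IH addrA.
Qed.

Lemma dideal_gen_mul P Q : dp_coeffs_in K P -> J Q -> J (DPmul P Q).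
Proof.
move=> hP [hQ [l [hl el]]]; split; first by split.
exists [seq (DPmul P t.1.1, t.1.2, t.2) | t <- l]; split.
  by elim: l hl {el} => //= t l IH [[h1 h2] /IH h].
move=> a /=; rewrite el; elim: l {hl el} => [|t l IH] /=; first by rewrite mulr0.
by rewrite -IH mulrDr mulrA.
Qed.

Lemma dideal_gen_iter k P : dp_coeffs_in K P -> S P -> J (iter k (@dp_deriv E D V) P).
Proof.
move=> hP SP; split; first by apply: dp_coeffs_iter_deriv => // c; exact: (dsubfield_der dsK).
by exists [:: (DPc 1, k, P)]; split=> // a /=; rewrite mul1r addr0.
Qed.

Lemma dideal_gen_min (J' : dpoly E V -> Prop) : is_dideal D K J' ->
  (forall P, S P -> J' P) -> forall P, J P -> J' P.
Proof.
move=> [_ [J0 [Jeq [Jadd [Jmul Jder]]]]] hS P [hP [l [hl el]]].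
apply: (Jeq _ _ hP (fun a => esym (el a))).
elim: l hl {el} => //= t l IH [[h1 /hS h2] /IH h]; apply: (Jadd) => //; apply: Jmul => //.
by elim: (t.1.2) => //= k; exact: Jder.
Qed.

End GeneratedIdeal.

Lemma is_prime_dideal_ext (E : fieldType) (D : E -> E) (K : E -> Prop) (V : Type)
    (J J' : dpoly E V -> Prop) :
  (forall P, J P <-> J' P) -> is_prime_dideal D K J -> is_prime_dideal D K J'.
Proof.
move=> e [[h1 [h2 [h3 [h4 [h5 h6]]]]] h7 h8]; split; last 2 first.
- by move/e.
- by move=> P Q hP hQ /e/(h8 _ _ hP hQ)[/e|/e]; [left|right].
split; first by move=> P /e/h1.
split; first exact/e.
split; first by move=> P Q hQ ePQ /e hP; apply/e; exact: h3 hP.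
split; first by move=> P Q /e hP /e hQ; apply/e; exact: h4.
split; first by move=> P Q hP /e hQ; apply/e; exact: h5.
by move=> P /e hP; apply/e; exact: h6.
Qed.

Section Generic.
Variables (E : fieldType) (D : E -> E) (n s r : nat).
Local Notation V := (monom n s r).
Implicit Types (m : V) (u : V -> E).

Lemma dp_eval_monom a m :
  dp_eval a (dp_monom E m) = \prod_(v : 'I_n * 'I_s.+1) a v.1 v.2 ^+ (val m v).
Proof.
have := dp_eval_bigmul a (fun v : 'I_n * 'I_s.+1 => dp_pow (DPv E v.1 v.2) (val m v)) (enum predT).
rewrite big_enum => ->; apply: eq_bigr => v _; exact: dp_eval_pow.
Qed.

Lemma dp_coeffs_monom (K : E -> Prop) m : K 1 -> dp_coeffs_in K (dp_monom E m).
Proof. by move=> K1; apply: dp_coeffs_bigmul => // v; exact: dp_coeffs_pow. Qed.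

Lemma dp_eval_generic a u : dp_eval a (generic_dpoly u) = \sum_m u m * dp_eval a (dp_monom E m).
Proof.
have := dp_eval_bigadd a (fun m => DPmul (DPc (u m)) (dp_monom E m)) (enum predT).
by rewrite big_enum.
Qed.

Lemma dp_map_generic (g : E -> E) (F : E -> Prop) u : g 0 = 0 ->
  F 1 -> (forall c, F c -> g c = c) -> dp_map g (generic_dpoly u) = generic_dpoly (g \o u).
Proof.
move=> g0 F1 hg; have gF (P : dpoly E 'I_n) : dp_coeffs_in F P -> dp_map g P = P.
  by elim: P => //= [c /hg->|P IHP Q IHQ [/IHP-> /IHQ->]|P IHP Q IHQ [/IHP-> /IHQ->]].
rewrite /generic_dpoly; elim: (enum _) => [|m l IH] /=; first by rewrite g0.
by rewrite IH gF //; exact: dp_coeffs_monom.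
Qed.

(** The coefficients become indeterminates because the elimination substitutes for them; setting
    them to [u] gives back the generic polynomial ([evu_generic]). *)
Definition generic_var : dpoly E (V + 'I_n) :=
  dp_big (@DPadd E _) 0 (fun m => DPmul (DPv E (inl m) 0%N)
    (dsubst (fun i j => DPv E (inr i) j) (dp_monom E m))) (enum predT).

Lemma dp_coeffs_generic_var (K : E -> Prop) : K 0 -> K 1 -> dp_coeffs_in K generic_var.
Proof.
move=> K0 K1; apply: dp_coeffs_bigadd => // m; split=> //.
by apply: dp_coeffs_dsubst => //; exact: dp_coeffs_monom.
Qed.

Lemma evu_generic u : evu D u generic_var = generic_dpoly u.
Proof.
have ren P : evu D u (dsubst (fun i j => DPv E (inr i) j) P) = P.
  by elim: P => //= P hP Q hQ; rewrite /evu /= in hP hQ *; rewrite hP hQ.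
rewrite /generic_var /generic_dpoly; elim: (enum _) => //= m l IH.
by rewrite /evu /= -!/(evu D u _) IH ren.
Qed.

Lemma evu_deriv u (P : dpoly E (V + 'I_n)) k :
  evu D u (iter k (@dp_deriv E D _) P) = iter k (@dp_deriv E D _) (evu D u P).
Proof.
have one Q : evu D u (dp_deriv D Q) = dp_deriv D (evu D u Q).
  by elim: Q => //= [[v|w] j|Q hQ R hR|Q hQ R hR] //; rewrite /evu /= in hQ hR *; rewrite hQ hR.
by elim: k => //= k IH; rewrite one IH.
Qed.

Lemma dp_eval_generic_var a b :
  dp_eval (comb a b) generic_var = \sum_m a m 0%N * dp_eval b (dp_monom E m).
Proof.
rewrite dp_eval_bigadd big_enum; apply: eq_bigr => m _ /=.
by rewrite dp_eval_dsubst; congr (_ * _); apply: dp_eval_ext.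
Qed.

Lemma monom_one : exists m : V, forall a, dp_eval a (dp_monom E m) = 1.
Proof.
pose f : {ffun 'I_n * 'I_s.+1 -> 'I_r.+1} := [ffun=> ord0].
have h : (\sum_v (f v : nat) <= r)%N.
  by rewrite big1 // => v _; rewrite ffunE.
exists (exist (fun m : {ffun 'I_n * 'I_s.+1 -> 'I_r.+1} => (\sum_v (m v : nat) <= r)%N) f h) => a;
  rewrite dp_eval_monom big1 // => v _.
by rewrite /= ffunE.
Qed.

Lemma monom_var (i0 : 'I_n) : (0 < r)%N ->
  exists m : V, forall a, dp_eval a (dp_monom E m) = a i0 s.
Proof.
move=> r0; pose f : {ffun 'I_n * 'I_s.+1 -> 'I_r.+1} :=
  [ffun v => if v == (i0, ord_max) then inord 1 else ord0].
have fE v : f v = (v == (i0, ord_max)) :> nat.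
  by rewrite ffunE; case: eqP => // _; rewrite inordK.
have h : (\sum_v (f v : nat) <= r)%N.
  rewrite (bigD1 (i0, ord_max)) //= big1 => [|v /negPf ne]; last by rewrite fE ne.
  by rewrite fE eqxx addn0.
exists (exist (fun m : {ffun 'I_n * 'I_s.+1 -> 'I_r.+1} => (\sum_v (m v : nat) <= r)%N) f h) => a;
  rewrite dp_eval_monom (bigD1 (i0, ord_max)) //= big1 => [|v /negPf ne].
  by rewrite fE eqxx expr1 mulr1.
by rewrite fE ne expr0.
Qed.

Lemma monom_ord (F : E -> Prop) (eta : 'I_n -> E) m :
  fld (extx F (jet D eta) (fun ij => (ij.2 < s.+1)%N)) (dp_eval (djet D eta) (dp_monom E m)).
Proof.
rewrite dp_eval_monom; elim/big_ind: _ => [|a b|v _]; [exact: fld1|exact: fldM|apply: fldX].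
by apply: fld_in; right; exists (v.1, v.2 : nat) => /=.
Qed.

End Generic.

(** * Intersection of a prime differential ideal with a generic differential hypersurface *)

Theorem theorem1p1 (E : fieldType) (D : E -> E) (F : E -> Prop)
  (n : nat) (I : dpoly E 'I_n -> Prop) (d h s r : nat)
  (u : monom n s r -> E) :
  is_derivation D -> [pchar E] =i pred0 ->
  is_dsubfield D F -> universal D F ->
  is_prime_dideal D F I -> dim_order D F I d h ->
  (0 < r)%N -> dindep D F [seq u m | m <- enum (predT : pred (monom n s r))] ->
  let K1 := dfgen D F u in
  let I1 := dideal_gen D K1 (fun P => I P \/ P = generic_dpoly u) in
  ((0 < d)%N -> is_prime_dideal D K1 I1 /\ dim_order D K1 I1 d.-1 (h + s)) /\
  (d = 0%N -> I1 (DPc 1)).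
Proof.
move=> derD pchar0 dsF univ primeI [eta [genI _ [T0 hT0]]] r_gt0 indu K1 I1.
have IF P : I P -> dp_coeffs_in F P by case: primeI => -[hI _] _ _; exact: hI.
have Fs := dsubfield_fld dsF.
have F0 := dsubfield0 dsF; have F1 := dsubfield1 dsF.
have dsK1 : is_dsubfield D K1 by exact: dfgen_dsubfield.
have iu : findep F (jet D u) by exact: ((dindep_findep D pchar0 u Fs).1 indu).
have [w0 iw0] := exists_generic derD pchar0 dsF eta (monom n s r) univ.
(* [jets_upto eta t] includes order [t] while [jidx] stops below it, hence the shifted threshold and
   [d * t] instead of [d * t.+1]. *)
have growth t : (T0.+1 <= t)%N -> rk F (map (jet D eta) (jidx 'I_n t)) = (d * t + h)%N.
  case: t => // t ht; have /(trdegP pchar0 Fs) <- := hT0 t ht.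
  rewrite -jets_jidx; congr (rk F (flatten _)); apply: eq_map => j.
  by rewrite -map_comp.
have [v0 mon_v0] := monom_one E n s r.
pose mon (m : monom n s r) := dp_eval (djet D eta) (dp_monom E m).
have mon_ord m : fld (extx F (jet D eta) (fun ij => (ij.2 < s.+1)%N)) (mon m).
  exact: monom_ord.
pose w1 := - \sum_(m | m != v0) w0 m * mon m.
pose z := shifted D w0 v0 eta (generic_var E n s r).
have zE m : z m = if m == v0 then w1 else w0 m.
  rewrite /z /shifted dp_eval_generic_var /djet /= (bigD1 v0) //= mon_v0 mulr1.
  by rewrite opprD addrA subrr sub0r.
have genK1 : dp_coeffs_in K1 (generic_dpoly u).
  by rewrite -(evu_generic D); apply: dp_coeffs_evu => //; exact: dp_coeffs_generic_var.
have elim_I1 P : dp_coeffs_in F P ->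
    dp_eval (comb (djet D z) (djet D eta)) P = 0 -> I1 (evu D u P).
  apply: (elim_ideal (I1 := I1) derD pchar0 dsF (dp_coeffs_generic_var n s r F0 F1) genI iw0).
  - exact: dideal_gen0.
  - by move=> Q R; exact: dideal_gen_eq.
  - exact: dideal_gen_add.
  - exact: dideal_gen_mul.
  - move=> Q hQ; apply: (dideal_gen_iter dsK1 0); last by left.
    by apply: dp_coeffs_mono (IF _ hQ) => c; exact: dfgen_base.
  - by move=> k; rewrite evu_deriv evu_generic; apply: dideal_gen_iter => //; right.
split=> [d_gt0|d0].
- have [i0 trans_i0] := exists_transcendental derD pchar0 dsF d_gt0 growth.
  have [m0 mon_m0] := monom_var E s i0 r_gt0.
  (* Were [m0] the monomial 1, the transcendental jet of [eta] at [(i0, s)] would equal 1. *)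
  have ne_m0 : m0 != v0.
    apply/eqP => e; apply: (trans_i0 s); rewrite -[jet D eta (i0, s)]/(djet D eta i0 s).
    by rewrite -mon_m0 e mon_v0; exact: cl1.
  have iz : findep F (jet D z).
    apply: (shifted_rank derD dsF iw0 mon_ord zE) => k.
    exact: (v_notin derD dsF iw0 ne_m0 mon_ord (mon_m0 _) trans_i0).
  pose J := sp_ideal D F u z eta.
  have primeJ : is_prime_dideal D K1 J by exact: sp_ideal_prime.
  have sgF c : F c -> sigma D F u z c = c by exact: sigma_base.
  (* From [J] to [I1]: clear denominators, eliminate, and divide by the nonzero value of [q] at [u].
     Conversely the generators lie in [J], as [sigma] fixes F and carries [u] to [z], whose
     polynomial vanishes at [eta]. *)
  have eqJ P : J P <-> I1 P.
    split.
      case=> kP hP; have [q [Pt [hq hPt nq e]]] := clear_denoms pchar0 dsF iu iz kP.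
      have hI : I1 (evu D u Pt).
        by apply: elim_I1 => //; rewrite -(e (djet D eta)).2 hP mulr0.
      have kq : K1 (dp_eval (djet D u) q)^-1.
        by apply/(dfgen_fld dsF)/fldV/fld_in/dfgen_eval.
      apply: (dideal_gen_eq kP) (dideal_gen_mul (P := DPc _) kq hI) => b.
      by rewrite /= dp_eval_evu -(e b).1 mulKf.
    apply: dideal_gen_min; first by case: primeJ.
    move=> Q [hQ|->]; split.
    + by apply: dp_coeffs_mono (IF _ hQ) => c; exact: dfgen_base.
    + by rewrite (dp_map_id pchar0 dsF iu iz (IF Q hQ)); exact: ((genI Q (IF Q hQ)).1 hQ).
    + exact: genK1.
    + rewrite (dp_map_generic (F := F)) ?sgF // dp_eval_generic.
      have sgu m : sigma D F u z (u m) = z m by exact: (sigma_jet pchar0 dsF iu iz m 0).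
      under eq_bigr => m _ do rewrite /= sgu -/(mon m).
      rewrite (bigD1 v0) //= zE eqxx /mon mon_v0 mulr1 -/mon.
      rewrite (eq_bigr (fun m => w0 m * mon m)); first by rewrite /w1 addNr.
      by move=> m /negPf ne; rewrite zE ne.
  split; first exact: is_prime_dideal_ext primeJ.
  have [eta' geneta'] := univ _ u n J primeJ.
  have growth' t : (maxn T0.+1 s <= t)%N ->
      rk K1 (map (jet D eta') (jidx 'I_n t)) = (d.-1 * t + (h + s))%N.
    rewrite geq_max => /andP[leT les].
    rewrite (transport_rk pchar0 dsF iu iz geneta') ?uniq_jidx //.
    apply: (rk_order derD dsF iw0 ne_m0 mon_ord (mon_m0 _) trans_i0 zE) => //.
    exact: growth.
  exists eta'; split.
  + by move=> P hP; rewrite -eqJ; exact: geneta'.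
  + apply: (dtrdeg_of_growth derD pchar0 dsK1 (h := h + s) (T := maxn T0.+1 s)) => t ht.
    by rewrite /djets jets_jidx; exact: growth'.
  + exists (maxn T0.+1 s) => t ht; apply/(trdegP pchar0 (dfgen_fld dsF (x := u))).
    rewrite -(growth' t.+1) ?leqW // -jets_jidx; congr (rk _ (flatten _)).
    by apply: eq_map => j; rewrite -map_comp.
- have nz : ~ findep F (jet D z).
    move=> iz; pose A (vj : monom n s r * nat) : Prop := vj.1 != v0.
    pose Y k := extx F (jet D z) (fun vj => A vj \/ (vj.1 = v0 /\ (vj.2 < k)%N)).
    (* For d = 0 the jets of [eta] have rank [h] at every large order, too small for [h.+1]
       independent derivatives of [w1]. *)
    pose N := h.+1; pose t := maxn T0.+1 (N + s).
    have := rk_v_le derD dsF v0 iw0 mon_ord (leq_maxr T0.+1 (N + s)).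
    rewrite growth ?leq_maxl // d0 mul0n add0n (chain_rk (Y := Y)); first by rewrite ltnn.
    + move=> j _; have := @findep_notin _ _ _ _ iz (fun vj => A vj \/
        (vj.1 = v0 /\ (vj.2 < j)%N)) (v0, j).
      rewrite /jet /= zE eqxx => h1; apply: h1 => -[]; first by rewrite /A eqxx.
      by case=> _; rewrite ltnn.
    + move=> i j b le [hb|[vj [hv|[e hv]] ->]]; [by left|right; exists vj => //|right;
        exists vj => //].
        by left.
      by right; split=> //; exact: leq_trans le.
    + move=> j; apply: cl_in; right; exists (v0, j); first by right.
      by rewrite /jet /= zE eqxx.
    + move=> b [hb|[[m j] hm ->]]; apply: cl_in; first by left.
      by right; exists (m, j); [left|rewrite /jet /= zE (negPf hm)].
  have [P [hP eP nP]] : exists P, [/\ dp_coeffs_in F P, dp_eval (djet D z) P = 0 &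
      ~ forall a, dp_eval a P = 0].
    apply: NNPP => hno; apply: nz; apply: (dp0_findep pchar0 Fs) => P hP eP.
    by apply: NNPP => hn; apply: hno; exists P.
  pose Pt := dsubst (fun v j => DPv E (inl v : monom n s r + 'I_n) j) P.
  have hPt : dp_coeffs_in F Pt by apply: dp_coeffs_dsubst.
  have PtE a b : dp_eval (comb a b) Pt = dp_eval a P.
    by rewrite dp_eval_dsubst; apply: dp_eval_ext.
  have hI : I1 (evu D u Pt) by apply: elim_I1 => //; rewrite PtE.
  have nPu : dp_eval (djet D u) P != 0.
    by apply/eqP => e; apply: nP; exact: (findep_dp0 pchar0 iu hP).
  have kq : K1 (dp_eval (djet D u) P)^-1.
    by apply/(dfgen_fld dsF)/fldV/fld_in/dfgen_eval.
  apply: dideal_gen_eq (dideal_gen_mul (P := DPc _) kq hI).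
    exact: dfgen_base.
  by move=> b; rewrite /= dp_eval_evu PtE mulVf.
Qed.
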